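(* Let $Q\in L^2_{\mathrm{loc}}(\mathbb{R})$ be real-valued, let $E_0=\inf\sigma(H_Q)$, and suppose $H_Q$ has a positive ground state $\psi$ (a positive distributional solution of $-\psi''+Q\psi=E_0\psi$) such that $\int_0^\infty\psi(t)^{-2}\,dt=\infty$ and $\int_{-\infty}^0\psi(t)^{-2}\,dt=\infty$. If $V\in L^2_{\mathrm{loc}}(\mathbb{R})$ is real-valued and both $H_{Q+V}$ and $H_{Q-V}$ are bounded below by $E_0$ (in the quadratic form sense on $C_c^\infty(\mathbb{R})$), then $V\equiv0$.
   Context: For a real potential $W$ on $\mathbb{R}$, $H_W=-\frac{d^2}{dx^2}+W$ is the Schrödinger operator on $L^2(\mathbb{R})$, defined through its quadratic form $\int|\phi'|^2+W|\phi|^2$. The ground-state energy is the infimum of the spectrum. *)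

(* Defs.v *)
From HB Require Import structures.
From mathcomp Require Import all_boot all_order all_algebra.
From mathcomp Require Import all_classical all_reals all_analysis.
Set Implicit Arguments. Unset Strict Implicit. Unset Printing Implicit Defensive.
Import Order.TTheory GRing.Theory Num.Theory.
Import numFieldNormedType.Exports.
Local Open Scope classical_set_scope.
Local Open Scope ring_scope.

Section Defs.
Variable R : realType.
Local Notation mu := (@lebesgue_measure R).

Definition smooth_compact (phi : R -> R) : Prop :=
  (forall (n : nat) (x : R), derivable (derive1n n phi) x 1) /\
  (exists M : R, forall x : R, M < `|x| -> phi x = 0).

Definition L1loc (f : R -> R) : Prop :=
  measurable_fun setT f /\
  forall a b : R, mu.-integrable `[a, b] (fun x => (f x)%:E).

Definition L2loc (f : R -> R) : Prop :=
  measurable_fun setT f /\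
  forall a b : R, mu.-integrable `[a, b] (fun x => (f x ^+ 2)%:E).

Definition qform (W phi : R -> R) : R :=
  Rintegral mu setT (fun x => (derive1 phi x) ^+ 2 + W x * (phi x) ^+ 2).

Definition l2norm2 (phi : R -> R) : R :=
  Rintegral mu setT (fun x => (phi x) ^+ 2).

Definition form_bounded_below (W : R -> R) (E : R) : Prop :=
  forall phi, smooth_compact phi -> E * l2norm2 phi <= qform W phi.

(* E0 = inf sigma(H_W), i.e. the infimum of the Rayleigh quotient of the
   form of H_W over the form core C_c^infty(R) *)
Definition bottom_of_spectrum (W : R -> R) (E0 : R) : Prop :=
  form_bounded_below W E0 /\
  (forall E, form_bounded_below W E -> E <= E0).

Definition weak_solution (W : R -> R) (E : R) (psi : R -> R) : Prop :=
  L1loc psi /\ L1loc (fun x => W x * psi x) /\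
  forall phi, smooth_compact phi ->
    Rintegral mu setT
      (fun x => - (psi x * derive1n 2 phi x) + (W x - E) * psi x * phi x) = 0.

Definition positive_ground_state (W : R -> R) (E : R) (psi : R -> R) : Prop :=
  weak_solution W E psi /\ (forall x, 0 < psi x).

End Defs.

(* Main.v *)
(* The weak solution psi agrees almost everywhere with a C^1 function Psi whose
   derivative is absolutely continuous (du Bois-Reymond, twice), and Psi > 0 by
   uniqueness for the ODE.  Substituting eta = Psi f turns the two form bounds into
   |int V Psi^2 f^2| <= int Psi^2 f'^2 for all compactly supported C^1 functions f.
   With W the primitive of Psi^-2, which tends to +oo and -oo by hypothesis,
   f = chi(W / T) is 1 on [-N, N] while int Psi^2 f'^2 = O(1 / T): constants are
   limits of functions of vanishing energy.  Perturbing f by t g then gives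
   int V Psi^2 g = 0 for every test function g, hence V = 0.
   As Psi f is only C^1, the form bounds are first extended from smooth to C^1
   functions of compact support. *)
Require Import Defs.
From HB Require Import structures.
From mathcomp Require Import all_boot all_order all_algebra.
From mathcomp Require Import all_classical all_reals all_analysis.
From mathcomp Require Import measurable_realfun lra ring.
Import Order.TTheory GRing.Theory Num.Theory.
Import numFieldNormedType.Exports.
Local Open Scope classical_set_scope.
Local Open Scope ring_scope.

(** * Locally integrable functions and their primitives *)

Section locally_integrable_functions.
Set Implicit Arguments. Unset Strict Implicit.
Context {R : realType}.
Notation mu := (@lebesgue_measure R).
Implicit Types (f g F G : R -> R) (a b c x : R).

(** The weight Psi^-2 comes from the coordinate s = W(x): since ds = Psi^-2 dx, the energy int Psi^2
    f'^2 dx is the free Dirichlet energy int (df/ds)^2 ds. Divergence at both ends makes s run over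
    the whole line, and in dimension one stretching a cutoff by T divides its energy by T. The
    perturbation succeeds because f can be taken constant near the support of g, so that f' g' = 0:
    the energy gains only a term in t^2, whereas the potential side gains 2 t int V Psi^2 g. Both
    signs of V are used, since the unperturbed int V Psi^2 f^2 must itself be small in absolute
    value. The obstacle is low regularity. Q is only locally integrable after multiplication by
    continuous functions, so Psi' is merely absolutely continuous. Hence the pairs integrand /
    primitive of [is_primitive], and an integration by parts whose factors are one function of that
    kind and one C^1 function. *)

Lemma L1loc_integrable f a b : L1loc f -> mu.-integrable `[a, b] (EFin \o f).
Proof. by case. Qed.

Lemma continuous_L1loc f : continuous f -> L1loc f.
Proof.
move=> cf; split; first exact: continuous_measurable_fun.
move=> a b; apply: continuous_compact_integrable; first exact: segment_compact.
exact: continuous_subspaceT.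
Qed.

Lemma L1locD f g : L1loc f -> L1loc g -> L1loc (fun x => f x + g x).
Proof.
move=> [mf If] [mg Ig]; split=> [|a b]; first exact: measurable_funD.
exact: (integrableD _ (If a b) (Ig a b)).
Qed.

Lemma L1locN f : L1loc f -> L1loc (fun x => - f x).
Proof.
move=> [mf If]; split=> [|a b]; first exact: measurableT_comp.
by have := integrableN (If a b).
Qed.

Lemma L1locB f g : L1loc f -> L1loc g -> L1loc (fun x => f x - g x).
Proof. by move=> Lf Lg; apply: L1locD => //; exact: L1locN. Qed.

Lemma L1loc_normr f : L1loc f -> L1loc (fun x => `|f x|).
Proof.
move=> [mf If]; split=> [|a b]; first exact: measurableT_comp.
by have := integrable_norm (If a b).
Qed.

Lemma continuous_bounded_segment f a b : continuous f ->
  exists M, 0 < M /\ forall x, x \in `[a, b] -> `|f x| <= M.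
Proof.
move=> cf; have [ab|ab] := leP a b; last first.
  by exists 1; split=> // x; rewrite in_itv/= => /andP[ax /(le_trans ax)]; rewrite leNgt ab.
have cn : {within `[a, b], continuous (fun x => `|f x|)}.
  by apply: continuous_subspaceT => x; apply: continuous_comp; [exact: cf|exact: norm_continuous].
have [c _ cM] := EVT_max ab cn.
exists (`|f c| + 1); split; first by rewrite ltr_wpDl.
by move=> x /cM fx; rewrite (le_trans fx)// lerDl.
Qed.

Lemma L1locM f g : L1loc f -> continuous g -> L1loc (fun x => f x * g x).
Proof.
move=> [mf If] cg; split=> [|a b].
  by apply: measurable_funM => //; exact: continuous_measurable_fun.
have mg : measurable_fun `[a, b] g.
  by apply: measurable_funTS; exact: continuous_measurable_fun.
have [M [_ gM]] := @continuous_bounded_segment g a b cg.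
have bg : [bounded g x | x in `[a, b]].
  exists M; split=> [|y My x /= xab]; first exact: num_real.
  by rewrite (le_trans (gM _ xab))// ltW.
exact: (integrableMl _ (If a b) mg bg).
Qed.

Lemma L1locZ f c : L1loc f -> L1loc (fun x => c * f x).
Proof.
move=> Lf; rewrite (_ : (fun x => c * f x) = (fun x => f x * cst c x)).
  by apply: L1locM => // x; exact: cvg_cst.
by apply/funext => x; rewrite mulrC.
Qed.


Lemma Rintegral_itv_split f a b c : L1loc f -> a <= c -> c <= b ->
  \int[mu]_(t in `[a, b]) f t =
  \int[mu]_(t in `[a, c]) f t + \int[mu]_(t in `[c, b]) f t.
Proof.
move=> [mf If] ac cb.
have := @Rintegral_itvB R f (BLeft a) (BRight b) c (If a b).
rewrite !bnd_simp => /(_ ac cb) H.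
have -> : \int[mu]_(t in `[c, b]) f t = \int[mu]_(t in `]c, b]) f t.
  rewrite Rintegral_itv_obnd_cbnd//.
  by apply: integrableS (If c b) => //; exact: subset_itv_oc_cc.
by rewrite -H addrC subrK.
Qed.

(** Local absolute continuity of [F] with almost everywhere derivative [f], encoded by the integral
    identity so that no pointwise derivative is involved. The order [a <= b] is required because
    segments carry no orientation. *)
Definition is_primitive f F := L1loc f /\
  forall a b, a <= b -> \int[mu]_(t in `[a, b]) f t = F b - F a.

(* Empty segments make one of the two integrals vanish, so this is the signed integral from 0 to x. *)
Definition primitive f x : R :=
  \int[mu]_(t in `[0, x]) f t - \int[mu]_(t in `[x, 0]) f t.

Lemma Rintegral_itv_empty f a b : b <= a -> \int[mu]_(t in `[a, b]) f t = 0.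
Proof.
rewrite le_eqVlt => /predU1P[->|ba]; first by rewrite set_itv1 Rintegral_set1.
by rewrite set_itv_ge ?Rintegral_set0// bnd_simp -ltNge.
Qed.

Lemma primitiveP f : L1loc f -> is_primitive f (primitive f).
Proof.
move=> Lf; split=> // a b ab; rewrite /primitive.
have [a0|a0] := leP 0 a.
  have b0 := le_trans a0 ab.
  rewrite (Rintegral_itv_empty f b0) (Rintegral_itv_empty f a0).
  by rewrite (Rintegral_itv_split Lf a0 ab); ring.
have [b0|b0] := leP 0 b.
  rewrite (Rintegral_itv_empty f b0) (Rintegral_itv_empty f (ltW a0)).
  by rewrite (Rintegral_itv_split Lf (ltW a0) b0); ring.
rewrite (Rintegral_itv_empty f (ltW b0)) (Rintegral_itv_empty f (ltW a0)).
by rewrite (Rintegral_itv_split Lf ab (ltW b0)); ring.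
Qed.

Lemma primitive0 f : primitive f 0 = 0.
Proof. by rewrite /primitive subrr. Qed.

Lemma is_primitiveD f g F G : is_primitive f F -> is_primitive g G ->
  is_primitive (fun x => f x + g x) (fun x => F x + G x).
Proof.
move=> [Lf fF] [Lg gG]; split=> [|a b ab]; first exact: L1locD.
rewrite RintegralD//; [by rewrite fF// gG//; ring|exact: L1loc_integrable..].
Qed.

Lemma is_primitiveZ f F c : is_primitive f F ->
  is_primitive (fun x => c * f x) (fun x => c * F x).
Proof.
move=> [Lf fF]; split=> [|a b ab]; first exact: L1locZ.
by rewrite RintegralZl// ?fF//; [ring|exact: L1loc_integrable].
Qed.

Lemma is_primitiveB f g F G : is_primitive f F -> is_primitive g G ->
  is_primitive (fun x => f x - g x) (fun x => F x - G x).
Proof.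
move=> fF /(is_primitiveZ (-1)) gG.
have := is_primitiveD fF gG; rewrite /is_primitive.
by under eq_fun do rewrite mulN1r; under [X in _ /\ X]eq_forall do
  under eq_forall do rewrite !mulN1r.
Qed.

Lemma is_primitive_shift f F c :
  is_primitive f F -> is_primitive f (fun x => c + F x).
Proof. by move=> [Lf fF]; split=> // a b /fF ->; ring. Qed.

Lemma is_primitive_cst c : is_primitive (cst c) (fun x => c * x).
Proof.
split=> [|a b ab]; first by apply: continuous_L1loc => x; exact: cvg_cst.
rewrite Rintegral_cst//= lebesgue_measure_itv/= lte_fin.
case: ltP ab => [ab _|ba ab] /=; first by ring.
by rewrite (le_anti (introT andP (conj ab ba))) mulr0 subrr.
Qed.

Lemma is_primitive_le f g F G a b : is_primitive f F -> is_primitive g G ->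
  a <= b -> (forall x, x \in `[a, b] -> f x <= g x) -> F b - F a <= G b - G a.
Proof.
move=> [Lf fF] [Lg gG] ab fg; rewrite -fF// -gG//.
by apply: le_Rintegral => //; exact: L1loc_integrable.
Qed.

(** The mean value inequality for functions that need not be differentiable; the majorant is itself
    given through a primitive [G]. *)
Lemma is_primitive_norm_le f g F G a b : is_primitive f F -> is_primitive g G ->
  a <= b -> (forall x, x \in `[a, b] -> `|f x| <= g x) ->
  `|F b - F a| <= G b - G a.
Proof.
move=> fF gG ab fg; rewrite ler_norml; apply/andP; split; last first.
  by apply: (is_primitive_le fF gG ab) => x /fg; rewrite ler_norml => /andP[].
have := is_primitive_le (is_primitiveZ (-1) gG) fF ab.
rewrite -mulrBr mulN1r; apply=> x /fg.
by rewrite mulN1r ler_norml => /andP[].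
Qed.

End locally_integrable_functions.

(** * Derivatives, the fundamental theorem of calculus and the product rule *)

Section calculus.
Set Implicit Arguments. Unset Strict Implicit.
Context {R : realType}.
Notation mu := (@lebesgue_measure R).
Implicit Types (f g F G : R -> R) (a b c x : R).

Definition has_derivative F f := forall x : R, is_derive x 1 F (f x).

Lemma has_derivative_continuous F f : has_derivative F f -> continuous F.
Proof.
move=> dF x; apply/differentiable_continuous/derivable1_diffP.
exact: (@ex_derive _ _ _ _ _ _ _ (dF x)).
Qed.

Lemma has_derivativeE F f : has_derivative F f -> F^`()%classic = f.
Proof. by move=> dF; apply/funext => x; rewrite derive1E (@derive_val _ _ _ _ _ _ _ (dF x)). Qed.

Lemma has_derivativeP F : (forall x, derivable F x 1) <-> has_derivative F F^`()%classic.
Proof.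
split=> dF x; last exact: (@ex_derive _ _ _ _ _ _ _ (dF x)).
by rewrite derive1E; exact: derivableP.
Qed.

Lemma has_derivative_cst c : has_derivative (cst c) (cst 0).
Proof. by move=> x; exact: is_derive_cst. Qed.

Lemma has_derivative_id : has_derivative id (cst 1).
Proof. by move=> x; exact: is_derive_id. Qed.

Lemma has_derivativeD F G f g : has_derivative F f -> has_derivative G g ->
  has_derivative (fun x => F x + G x) (fun x => f x + g x).
Proof. by move=> dF dG x; apply: is_deriveD. Qed.

Lemma has_derivativeM F G f g : has_derivative F f -> has_derivative G g ->
  has_derivative (fun x => F x * G x) (fun x => F x * g x + G x * f x).
Proof. by move=> dF dG x; have := @is_deriveM _ _ F G x 1 (f x) (g x) (dF x) (dG x). Qed.

Lemma has_derivativeZ F f c : has_derivative F f ->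
  has_derivative (fun x => c * F x) (fun x => c * f x).
Proof. by move=> dF x; have := @is_deriveZ _ _ _ F c x 1 (f x) (dF x). Qed.

Lemma has_derivative_comp F G f g : has_derivative F f -> has_derivative G g ->
  has_derivative (fun x => F (G x)) (fun x => f (G x) * g x).
Proof. by move=> dF dG x; exact: (is_derive1_comp (dF _) (dG x)). Qed.

Lemma derivative_locally_cst F f c x : has_derivative F f ->
  (\forall y \near x, F y = c) -> f x = 0.
Proof.
move=> df fc; have d0 : is_derive x 1 F 0.
  apply: (near_eq_is_derive _ (is_derive_cst (c : R) x 1)).
  by apply: filterS fc => y ->.
by rewrite -(@derive_val _ _ _ _ _ _ _ (df x)) (@derive_val _ _ _ _ _ _ _ d0).
Qed.

Lemma near_segment x : \forall y \near x, y \in `[x - 1, x + 1].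
Proof.
have x1 : x \in `]x - 1, x + 1[ by rewrite in_itv/= ltrBlDr ltrDl ltr01.
by apply: filterS (near_in_itvoo x1) => y; exact: subset_itv_oo_cc.
Qed.

(** Serves where no differentiation rule applies: at the origin for [flat], and for the auxiliary
    function in the product rule [is_primitiveM]. *)
Lemma is_derive0_near F x (e : R -> R) :
  (\forall y \near x, `|F y - F x| <= `|y - x| * e y) ->
  e y @[y --> x] --> (0 : R) -> is_derive x 1 F 0.
Proof.
move=> Fe e0; apply/is_derive1_caratheodory.
exists (fun z => if z == x then 0 else (F z - F x) / (z - x)); split.
- move=> z; case: eqVneq => [->|zx]; first by rewrite !subrr mulr0.
  by rewrite divfK// subr_eq0.
- rewrite /prop_for /continuous_at eqxx.
  apply/cvgrPdist_lt => eps eps0; rewrite /=.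
  move/cvgrPdist_lt : e0 => /(_ _ eps0) e0.
  near=> z; rewrite sub0r normrN; case: eqVneq => [_|zx]; first by rewrite normr0.
  have zx0 : 0 < `|z - x| by rewrite normr_gt0 subr_eq0.
  rewrite normrM normfV ltr_pdivrMr//.
  have : `|F z - F x| <= `|z - x| * e z by near: z.
  move/le_lt_trans; apply; rewrite mulrC ltr_pM2r//.
  have : `|0 - e z| < eps by near: z.
  by rewrite sub0r normrN; exact/le_lt_trans/ler_norm.
- by rewrite eqxx.
Unshelve. all: by end_near. Qed.

(** A [parameterized_integral] starts at a fixed left end. Below, [c] is [x - 1] for the point [x]
    under study, so the identity holds in a neighbourhood of that point. *)
Lemma is_primitiveE f F c x : is_primitive f F -> c <= x ->
  F x = F c + parameterized_integral mu c x f.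
Proof. by move=> [_ fF] cx; rewrite /parameterized_integral fF//; ring. Qed.

Lemma is_primitive_continuous f F : is_primitive f F -> continuous F.
Proof.
move=> fF x; have x1 : x - 1 < x + 1 by lra.
have Lf := fF.1.
have := parameterized_integral_continuous (ltW x1) (L1loc_integrable (x - 1) (x + 1) Lf).
move/(continuous_within_itvP _ x1) => [+ _ _] => /(_ x).
rewrite in_itv/= ltrBlDr !ltrDl ltr01 => /(_ isT) cx.
have : {for x, continuous (fun y => F (x - 1) + parameterized_integral mu (x - 1) y f)}.
  by apply: (@continuousD _ _ _ (cst (F (x - 1)))); [exact: cvg_cst|exact: cx].
rewrite /prop_for /continuous_at -(is_primitiveE fF (ltW _)) ?ltrBlDr ?ltrDl//.
apply: cvg_trans; apply: near_eq_cvg; near=> y.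
rewrite [RHS](is_primitiveE (c := x - 1) fF)//.
suff : y \in `[x - 1, x + 1] by rewrite in_itv/= => /andP[].
by near: y; exact: near_segment.
Unshelve. all: by end_near. Qed.

Lemma is_primitive_derive f F x : is_primitive f F -> {for x, continuous f} ->
  is_derive x 1 F (f x).
Proof.
move=> fF cf; have Lf := fF.1.
have x1 : x - 1 < x by lra. have x2 : x < x + 1 by lra.
have [dP P'] := continuous_FTC1_closed x2 (L1loc_integrable (x - 1) (x + 1) Lf) x1 cf.
have dF := is_deriveD (is_derive_cst (F (x - 1)) x 1) (DeriveDef dP (etrans (esym (derive1E _ _)) P')).
rewrite add0r in dF; apply: near_eq_is_derive dF.
near=> y; rewrite [RHS](is_primitiveE (c := x - 1) fF)//.
suff : y \in `[x - 1, x + 1] by rewrite in_itv/= => /andP[].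
by near: y; exact: near_segment.
Unshelve. all: by end_near. Qed.

Lemma has_derivative_primitive F f : continuous f -> has_derivative F f -> is_primitive f F.
Proof.
move=> cf dF; have Lf := continuous_L1loc cf.
have fP := primitiveP Lf.
suff H x : F x - primitive f x = F 0 - primitive f 0.
  have -> : F = (fun x => (F 0 - primitive f 0) + primitive f x).
    by apply/funext => x; rewrite -(H x) subrK.
  exact: is_primitive_shift.
apply: (@is_derive_0_is_cst _ (F - primitive f)) => y.
have := is_deriveB (dF y) (is_primitive_derive fP (cf y)).
by rewrite subrr.
Qed.

(* With D = F G - (primitive of f G + F g), an increment of D over [x, y] is at
   most 2 M (y - x) times the integral of |f| over [x, y], so D' = 0. *)
Lemma is_primitiveM f F G g : is_primitive f F -> has_derivative G g ->
  continuous g -> is_primitive (fun x => f x * G x + F x * g x) (fun x => F x * G x).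
Proof.
move=> fF dG cg; have Lf := fF.1.
have cG := has_derivative_continuous dG.
have gG := has_derivative_primitive cg dG.
have cF := is_primitive_continuous fF.
pose h x := f x * G x + F x * g x.
have Lh : L1loc h.
  apply: L1locD; first exact: L1locM.
  by apply: continuous_L1loc => x; apply: continuousM; [exact: cF|exact: cg].
have hH := primitiveP Lh; set H := primitive h in hH.
have Lfn := L1loc_normr Lf.
have AP := primitiveP Lfn; set A := primitive _ in AP.
have cA := is_primitive_continuous AP.
pose D x := F x * G x - H x.
have incr c d M : (forall x, x \in `[c, d] -> `|g x| <= M) ->
    forall x y, x \in `[c, d] -> y \in `[c, d] -> x <= y ->
    `|D y - D x| <= 2 * M * (y - x) * (A y - A x).
  move=> gM x y xcd ycd xy.
  have gM' t : t \in `[x, y] -> `|g t| <= M.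
    move=> txy; apply: gM; move: xcd ycd txy; rewrite !in_itv/=.
    move=> /andP[cx _] /andP[_ yd] /andP[xt ty].
    by rewrite (le_trans cx)// (le_trans ty).
  have M0 : 0 <= M by rewrite (le_trans _ (gM _ xcd)).
  have Glip s t : x <= s -> s <= t -> t <= y -> `|G t - G s| <= M * (y - x).
    move=> xs st ty.
    have := is_primitive_norm_le gG (is_primitive_cst M) st.
    move=> /(_ _)/le_trans; apply.
      move=> u; rewrite in_itv/= => /andP[su ut]; apply: gM'.
      by rewrite in_itv/= (le_trans xs)// (le_trans ut).
    by rewrite -mulrBr ler_wpM2l//; lra.
  have Flip t : x <= t -> t <= y -> `|F x - F t| <= A y - A x.
    move=> xt ty; rewrite distrC.
    rewrite (le_trans (is_primitive_norm_le fF AP xt _))//.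
    have : A t - A t <= A y - A t; last by lra.
    rewrite subrr -(AP.2 _ _ ty); exact: Rintegral_ge0.
  (* Freezing the factors at [G y] and [F x] gives a function [U] with the same increment over
     [x, y] as [D], but whose integrand is f (G y - G t) + (F x - F t) g: each term is a product
     with a small increment. *)
  pose u t := (G y * f t + F x * g t) - h t.
  pose U t := (G y * F t + F x * G t) - H t.
  have uU : is_primitive u U.
    apply: is_primitiveB => //.
    by apply: is_primitiveD; exact: is_primitiveZ.
  pose v t := M * (y - x) * `|f t| + cst ((A y - A x) * M) t.
  pose V t := M * (y - x) * A t + (A y - A x) * M * t.
  have vV : is_primitive v V.
    apply: is_primitiveD; [exact: is_primitiveZ|exact: is_primitive_cst].
  have -> : D y - D x = U y - U x by rewrite /D /U; ring.
  have -> : 2 * M * (y - x) * (A y - A x) = V y - V x by rewrite /V; ring.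
  apply: (is_primitive_norm_le uU vV xy) => t txy.
  have := txy; rewrite in_itv/= => /andP[xt ty].
  have -> : u t = f t * (G y - G t) + (F x - F t) * g t by rewrite /u /h; ring.
  rewrite (le_trans (ler_normD _ _))// !normrM /v /=; apply: lerD.
    by rewrite mulrC ler_wpM2r// Glip.
  by apply: ler_pM => //; [exact: Flip|exact: gM'].
suff dD : has_derivative D (cst 0).
  have DE x : F x * G x = D 0 + H x.
    by rewrite -(@is_derive_0_is_cst _ D x 0 dD) /D subrK.
  rewrite (_ : (fun x => F x * G x) = (fun x => D 0 + H x)); last exact/funext.
  exact: is_primitive_shift.
move=> x.
have [M [M0 gM]] := continuous_bounded_segment (x - 1) (x + 1) cg.
apply: (@is_derive0_near _ _ (fun y => 2 * M * `|A y - A x|)); last first.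
  rewrite -[X in _ --> X](mulr0 (2 * M)); apply: cvgM; first exact: cvg_cst.
  rewrite -[X in _ --> X](@normr0 _ R); apply: cvg_norm.
  by rewrite -[X in _ --> X](subrr (A x)); apply: cvgB; [exact: cA|exact: cvg_cst].
have xI : x \in `[x - 1, x + 1] by rewrite in_itv/=; lra.
near=> y.
have yI : y \in `[x - 1, x + 1] by near: y; exact: near_segment.
have [yx|/ltW xy] := leP y x.
  have := incr _ _ _ gM _ _ yI xI yx; rewrite distrC => /le_trans; apply.
  rewrite (distrC (A y)) (distrC y) (ger0_norm (x := x - y)) ?subr_ge0//.
  by rewrite mulrAC mulrC ler_wpM2l ?subr_ge0// ler_wpM2l ?ler_norm// mulr_ge0// ltW.
have := incr _ _ _ gM _ _ xI yI xy => /le_trans; apply.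
rewrite (ger0_norm (x := y - x)) ?subr_ge0//.
by rewrite mulrAC mulrC ler_wpM2l ?subr_ge0// ler_wpM2l ?ler_norm// mulr_ge0// ltW.
Unshelve. all: by end_near. Qed.

Lemma L1loc_locally_integrable f : L1loc f -> locally_integrable setT f.
Proof.
move=> [mf If]; split=> [//||K _ cK]; first exact: openT.
have [M [_ KM]] := compact_bounded cK.
have KI : K `<=` `[- (`|M| + 1), `|M| + 1].
  move=> x Kx; have : `|x| <= `|M| + 1.
    by apply: (KM (`|M| + 1)) => //; rewrite (le_lt_trans (ler_norm _))// ltrDl.
  by rewrite /= in_itv/= ler_norml.
have /integrableP[_] := If (- (`|M| + 1)) (`|M| + 1).
apply: le_lt_trans; apply: ge0_subset_integral => //=.
- exact: compact_measurable.
- by apply/measurable_EFinP; apply: measurableT_comp => //; exact: measurable_funTS.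
Qed.

(** The derivative exists at each Lebesgue point of [f], and almost every point is one. *)
Lemma is_primitive_ae_derive f F : is_primitive f F ->
  {ae mu, forall x, is_derive x 1 F (f x)}.
Proof.
move=> fF; have Lf := fF.1.
have /lebesgue_differentiation := L1loc_locally_integrable Lf.
apply: (@filterS _ _ (ae_filter_ringOfSetsType mu)) => x fx.
have x1 : x - 1 < x by lra. have x2 : x < x + 1 by lra.
have x1' : ((x - 1)%:E < x%:E)%E by rewrite lte_fin.
have [dP P'] := @FTC1_lebesgue_pt _ _ (BLeft (x - 1)) _ _ x2 (L1loc_integrable (x - 1) (x + 1) Lf) x1' fx.
have dF := is_deriveD (is_derive_cst (F (x - 1)) x 1) (DeriveDef dP (etrans (esym (derive1E _ _)) P')).
rewrite add0r in dF; apply: near_eq_is_derive dF.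
near=> y; rewrite [RHS](is_primitiveE (c := x - 1) fF)//.
suff : y \in `[x - 1, x + 1] by rewrite in_itv/= => /andP[].
by near: y; exact: near_segment.
Unshelve. all: by end_near. Qed.

Lemma is_primitive0_ae f : is_primitive f (cst 0) -> {ae mu, forall x, f x = 0}.
Proof.
move=> /is_primitive_ae_derive.
apply: (@filterS _ _ (ae_filter_ringOfSetsType mu)) => x dF.
by rewrite -(@derive_val _ _ _ _ _ _ _ dF) derive_cst.
Qed.

Lemma Rintegral_ae_eq f g a b : measurable_fun setT f -> measurable_fun setT g ->
  {ae mu, forall x, f x = g x} ->
  \int[mu]_(t in `[a, b]) f t = \int[mu]_(t in `[a, b]) g t.
Proof.
move=> mf mg fg; congr fine; apply: ae_eq_integral => //.
- by apply/measurable_EFinP; exact: measurable_funTS.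
- by apply/measurable_EFinP; exact: measurable_funTS.
- by apply: (@filterS _ _ (ae_filter_ringOfSetsType mu)) fg => x -> _.
Qed.

Lemma Rintegral_compact_support f c : (forall x, c < `|x| -> f x = 0) ->
  \int[mu]_t f t = \int[mu]_(t in `[- c, c]) f t.
Proof.
move=> f0; rewrite [RHS]Rintegral_mkcond; apply: eq_Rintegral => x _.
rewrite patchE; case: ifPn => // /negP xc; apply: f0; rewrite ltNge.
by apply/negP => xc'; apply: xc; rewrite inE/= in_itv/= -ler_norml.
Qed.

End calculus.

(** * Smooth step functions *)

Section smooth_functions.
Set Implicit Arguments. Unset Strict Implicit.
Context {R : realType}.
Notation mu := (@lebesgue_measure R).
Implicit Types (f g F G : R -> R) (a b c x : R).

Definition smooth f := forall n x, derivable (derive1n n f) x 1.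

(** n-fold differentiability with derivatives given as witnesses. For all n together this is
    smoothness, and in this form sums, products and affine substitutions go by induction on n. *)
Fixpoint Ck n f : Prop :=
  if n is m.+1 then exists2 f', has_derivative f f' & Ck m f' else True.

Lemma smoothP f : smooth f <-> forall n, Ck n f.
Proof.
split=> [sf n|Cf n].
  elim: n f sf => //= n IHn f sf; exists f^`()%classic.
    by apply/has_derivativeP; exact: (sf 0%N).
  by apply: IHn => m x; rewrite -derive1Sn; exact: sf.
have {Cf} : Ck n.+1 f by exact: Cf.
elim: n f => [|n IHn] f [f' df Cf'] x; first exact: (@ex_derive _ _ _ _ _ _ _ (df x)).
by rewrite derive1Sn (has_derivativeE df); exact: IHn.
Qed.

Lemma CkW n f : Ck n.+1 f -> Ck n f.
Proof. by elim: n f => // n IHn f [f' df Cf']; exists f' => //; exact: IHn. Qed.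

Lemma Ck_cst n c : Ck n (cst c).
Proof. by elim: n c => //= n IHn c; exists (cst 0) => //; exact: has_derivative_cst. Qed.

Lemma CkD n f g : Ck n f -> Ck n g -> Ck n (fun x => f x + g x).
Proof.
elim: n f g => //= n IHn f g [f' df Cf] [g' dg Cg].
by exists (fun x => f' x + g' x); [exact: has_derivativeD|exact: IHn].
Qed.

Lemma CkM n f g : Ck n f -> Ck n g -> Ck n (fun x => f x * g x).
Proof.
elim: n f g => //= n IHn f g Cf Cg.
have [f' df Cf'] := Cf; have [g' dg Cg'] := Cg.
exists (fun x => f x * g' x + g x * f' x); first exact: has_derivativeM.
by apply: CkD; apply: IHn => //; exact: CkW.
Qed.

Lemma Ck_affine n f a b : Ck n f -> Ck n (fun x => f (a * x + b)).
Proof.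
elim: n f => //= n IHn f [f' df Cf'].
exists (fun x => f' (a * x + b) * a); last first.
  by apply: CkM; [exact: IHn|exact: Ck_cst].
apply: (has_derivative_comp df) => x.
have := has_derivativeD (has_derivativeZ a (@has_derivative_id R)) (has_derivative_cst b) x.
by rewrite /= mulr1 addr0.
Qed.

Lemma smooth_cst c : smooth (cst c).
Proof. by apply/smoothP => n; exact: Ck_cst. Qed.

Lemma smoothD f g : smooth f -> smooth g -> smooth (fun x => f x + g x).
Proof. by move=> /smoothP Cf /smoothP Cg; apply/smoothP => n; exact: CkD. Qed.

Lemma smoothM f g : smooth f -> smooth g -> smooth (fun x => f x * g x).
Proof. by move=> /smoothP Cf /smoothP Cg; apply/smoothP => n; exact: CkM. Qed.

Lemma smoothZ f c : smooth f -> smooth (fun x => c * f x).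
Proof. by move=> sf; exact: (@smoothM (cst c) f (@smooth_cst c) sf). Qed.

Lemma smooth_affine f a b : smooth f -> smooth (fun x => f (a * x + b)).
Proof. by move=> /smoothP Cf; apply/smoothP => n; exact: Ck_affine. Qed.

Lemma smooth_sum (I : Type) (r : seq I) (f : I -> R -> R) :
  (forall i, smooth (f i)) -> smooth (fun x => \sum_(i <- r) f i x).
Proof.
move=> sf; elim: r => [|i r IHr].
  by under eq_fun do rewrite big_nil; exact: smooth_cst.
by under eq_fun do rewrite big_cons; exact: smoothD.
Qed.

Lemma smooth_has_derivative f : smooth f -> has_derivative f f^`()%classic.
Proof. by move=> sf; apply/has_derivativeP; exact: (sf 0%N). Qed.

Lemma smooth_derive f : smooth f -> smooth f^`()%classic.
Proof. by move=> sf n x; rewrite -derive1Sn; exact: sf. Qed.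

Lemma smooth_continuous f : smooth f -> continuous f.
Proof. by move/smooth_has_derivative/has_derivative_continuous. Qed.

Lemma smooth_antiderivative F f : has_derivative F f -> smooth f -> smooth F.
Proof.
move=> dF sf [|n] x; first exact: (@ex_derive _ _ _ _ _ _ _ (dF x)).
by rewrite derive1Sn (has_derivativeE dF); exact: sf.
Qed.

(** The function x^-k exp(-1/x) on the right half-line. All k are treated at once because
    differentiation sends this family into its own linear span. *)
Definition flat k x : R := if 0 < x then x^-1 ^+ k * expR (- x^-1) else 0.

(** One term of the exponential series at y = 1/x gives exp y >= y^(k+2) / (k+2)!. The quadratic
    decay obtained is what makes the derivative at 0 vanish. *)
Lemma flat_le k x : `|flat k x| <= k.+2`!%:R * x ^+ 2.
Proof.
rewrite /flat; case: ifPn => [x0|_]; last by rewrite normr0 mulr_ge0// sqr_ge0.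
have y0 : 0 < x^-1 by rewrite invr_gt0.
rewrite ger0_norm; last by rewrite mulr_ge0 ?expR_ge0// exprn_ge0// ltW.
have H : x^-1 ^+ k.+2 / k.+2`!%:R <= expR x^-1.
  by rewrite (le_trans _ (expR_ge1Dxn k.+1 (ltW y0)))// lerDr.
rewrite expRN ler_pdivrMr ?expR_gt0//.
rewrite ler_pdivrMr ?ltr0n ?fact_gt0// in H.
have -> : x^-1 ^+ k = x^-1 ^+ k.+2 * x ^+ 2.
  by rewrite -addn2 exprD -mulrA -exprMn mulVf ?gt_eqF// expr1n mulr1.
by rewrite [leRHS]mulrAC ler_wpM2r ?sqr_ge0// mulrC.
Qed.

Lemma flat_derivative k :
  has_derivative (flat k) (fun x => flat k.+2 x - k%:R * flat k.+1 x).
Proof.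
move=> x; have [x0|x0|->] := ltgtP x 0.
- rewrite {2 3}/flat ltNge ltW//= mulr0 subr0.
  apply: near_eq_is_derive (is_derive_cst 0 x 1); near=> y.
  have y0 : y < 0 by near: y; exact: lt_nbhsl.
  by rewrite /flat ltNge ltW.
- rewrite {2 3}/flat x0.
  apply: (@near_eq_is_derive R R R (fun y => y^-1 ^+ k * expR (- y^-1)) (flat k) x 1).
    near=> y; have y0 : 0 < y by near: y; exact: lt_nbhsr.
    by rewrite /flat y0.
  have x00 : x != 0 by rewrite gt_eqF.
  have dV : is_derive x 1 (fun y => y^-1) (- x^-1 ^+ 2).
    by apply: is_derive_eq (is_deriveV x00 (is_derive_id x 1)) _; rewrite exprVn /GRing.scale/= mulr1.
  have dE : is_derive x 1 (fun y => expR (- y^-1)) (expR (- x^-1) * x^-1 ^+ 2).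
    apply: (@is_derive1_comp _ expR (fun y => - y^-1)).
    by rewrite -[_ ^+ 2]opprK; exact: is_deriveN.
  have dX : is_derive x 1 (fun y => y^-1 ^+ k) (k%:R * x^-1 ^+ k.-1 * (- x^-1 ^+ 2)).
    by have := is_deriveX k dV; rewrite exprfctE.
  have -> : x^-1 ^+ k.+2 * expR (- x^-1) - k%:R * (x^-1 ^+ k.+1 * expR (- x^-1)) =
      x^-1 ^+ k * (expR (- x^-1) * x^-1 ^+ 2) +
      expR (- x^-1) * (k%:R * x^-1 ^+ k.-1 * (- x^-1 ^+ 2)).
    by case: k {dX} => [|k] /=; rewrite ?expr0 ?exprS; ring.
  exact: (is_deriveM dX dE).
- rewrite {2 3}/flat ltxx mulr0 subr0.
  apply: (@is_derive0_near _ _ _ (fun y => k.+2`!%:R * `|y|)).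
    near=> y; rewrite {2}/flat ltxx !subr0 (le_trans (flat_le k y))//.
    by rewrite -real_normK ?num_real// expr2 mulrCA.
  rewrite -[X in _ --> X](mulr0 (k.+2`!%:R)); apply: cvgM; first exact: cvg_cst.
  by rewrite -[X in _ --> X](@normr0 _ R); apply: cvg_norm; exact: cvg_id.
Unshelve. all: by end_near. Qed.

Lemma flat_smooth k : smooth (flat k).
Proof.
apply/smoothP => n; elim: n k => //= n IHn k.
exists (fun x => flat k.+2 x - k%:R * flat k.+1 x); first exact: flat_derivative.
apply: CkD => //; rewrite (_ : (fun x => _) = (fun x => - k%:R * flat k.+1 x)).
  by apply: CkM => //; exact: Ck_cst.
by apply/funext => x; rewrite mulNr.
Qed.

(** The normalised antiderivative of the bump flat(x) flat(1 - x), which is positive exactly on (0,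
    1). *)
Lemma smooth_step : exists theta : R -> R, [/\ smooth theta,
  forall x, x <= 0 -> theta x = 0, forall x, 1 <= x -> theta x = 1,
  {homo theta : x y / x <= y} & forall x, 0 <= theta x <= 1].
Proof.
pose b x := flat 0 x * flat 0 (-1 * x + 1).
have sb : smooth b by apply: smoothM; [|apply: smooth_affine]; exact: flat_smooth.
have cb := smooth_continuous sb.
have bP := primitiveP (continuous_L1loc cb); set B := primitive b in bP.
have b_ge0 x : 0 <= b x.
  by rewrite /b /flat; do 2 case: ifP => _; rewrite ?mulr0 ?mul0r// !mulr_ge0 ?expR_ge0.
have b_gt0 x : 0 < x -> x < 1 -> 0 < b x.
  move=> x0 x1; rewrite /b /flat x0 mulN1r addrC subr_gt0 x1.
  by rewrite !mulr_gt0 ?expR_gt0 ?exprn_gt0 ?invr_gt0 ?subr_gt0.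
have b0 x : ~~ (0 < x < 1) -> b x = 0.
  rewrite negb_and /b /flat mulN1r (addrC _ 1) subr_gt0.
  by case/orP => /negPf ->; rewrite ?mul0r ?mulr0.
have Bmono : {homo B : x y / x <= y}.
  move=> x y xy; rewrite -subr_ge0 -(bP.2 _ _ xy); apply: Rintegral_ge0 => t _.
  exact: b_ge0.
have B0 x : x <= 0 -> B x = 0.
  move=> x0; apply/eqP; rewrite -oppr_eq0 -(sub0r (B x)) -{1}(primitive0 b) -/B.
  rewrite -(bP.2 _ _ x0) (@eq_Rintegral _ _ _ _ _ (cst 0)).
    by rewrite Rintegral_cst// mul0r.
  move=> t; rewrite inE/= in_itv/= => /andP[_ t0]; apply: b0.
  by rewrite negb_and -leNgt t0.
have B1 x : 1 <= x -> B x = B 1.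
  move=> x1; apply/eqP; rewrite -subr_eq0 -(bP.2 _ _ x1).
  rewrite (@eq_Rintegral _ _ _ _ _ (cst 0)); first by rewrite Rintegral_cst// mul0r.
  move=> t; rewrite inE/= in_itv/= => /andP[t1 _]; apply: b0.
  by rewrite negb_and -!leNgt t1 orbT.
have dB : has_derivative B b by move=> x; apply: (is_primitive_derive bP); exact: cb.
have B1_gt0 : 0 < B 1.
  have [c] := @MVT R B b 0 1 ltr01 (fun x _ => dB x)
    (continuous_subspaceT (has_derivative_continuous dB)).
  rewrite in_itv/= => /andP[c0 c1]; rewrite (B0 0)// !subr0 mulr1 => ->.
  exact: b_gt0.
pose theta x := (B 1)^-1 * B x.
have t0 x : x <= 0 -> theta x = 0 by move=> /B0 xB; rewrite /theta xB mulr0.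
have t1 x : 1 <= x -> theta x = 1.
  by move=> /B1 xB; rewrite /theta xB mulVf// gt_eqF.
have tm : {homo theta : x y / x <= y}.
  by move=> x y /Bmono xy; rewrite ler_pM2l ?invr_gt0.
exists theta; split=> //; first exact/smoothZ/(smooth_antiderivative dB).
move=> x; apply/andP; split.
  by have [/t0 ->//|/ltW/tm] := leP x 0; rewrite t0.
by have [/t1 ->//|/ltW/tm] := leP 1 x; rewrite (t1 1).
Qed.

End smooth_functions.

(** * Smooth approximation in C^1 *)

Section approximation.
Set Implicit Arguments. Unset Strict Implicit.
Context {R : realType}.
Notation mu := (@lebesgue_measure R).
Implicit Types (f g F G : R -> R) (a b c x : R).

Definition compact_support f := exists c, forall x, c < `|x| -> f x = 0.

Lemma compact_supportMl f g : compact_support f -> compact_support (fun x => f x * g x).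
Proof. by move=> [c fc]; exists c => x /fc ->; rewrite mul0r. Qed.

Lemma compact_supportMr f g : compact_support g -> compact_support (fun x => f x * g x).
Proof. by move=> [c fc]; exists c => x /fc ->; rewrite mulr0. Qed.

Lemma compact_supportD f g : compact_support f -> compact_support g ->
  compact_support (fun x => f x + g x).
Proof.
move=> [c fc] [d gd]; exists (Num.max c d) => x; rewrite gt_max => /andP[/fc -> /gd ->].
by rewrite addr0.
Qed.

Lemma compact_supportX f n : compact_support f -> compact_support (fun x => f x ^+ n.+1).
Proof. by move=> [c fc]; exists c => x /fc ->; rewrite expr0n. Qed.

Lemma derivative_support F f c : has_derivative F f ->
  (forall x, c < `|x| -> F x = 0) -> forall x, c < `|x| -> f x = 0.
Proof.
move=> dF F0 x cx; apply: (derivative_locally_cst (c := 0) dF).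
have := @norm_continuous _ R x; move/cvgrPdist_lt.
have cx0 : 0 < `|x| - c by rewrite subr_gt0.
move=> /(_ _ cx0) nx; near=> y; apply: F0.
have : `| `|x| - `|y| | < `|x| - c by near: y.
by move=> /(le_lt_trans (ler_norm _)); lra.
Unshelve. all: by end_near. Qed.

Lemma compact_support_integrable f : L1loc f -> compact_support f ->
  mu.-integrable setT (EFin \o f).
Proof.
move=> Lf [c f0].
have -> : EFin \o f = (EFin \o f) \_ `[- c, c].
  apply/funext => x; rewrite patchE; case: ifPn => //= /negP xc; rewrite f0// ltNge.
  by apply/negP => xc'; apply: xc; rewrite inE/= in_itv/= -ler_norml.
by apply: (integrable_mkcond _ _).1; [exact: measurable_itv|exact: L1loc_integrable].
Qed.

Lemma compact_support_primitive f F : is_primitive f F ->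
  compact_support f -> compact_support F -> \int[mu]_t f t = 0.
Proof.
move=> fF [c fc] [d Fd].
(* Nonnegative and strictly beyond both radii, so that [F] vanishes at both [m] and [- m]. *)
pose m := `|c| + `|d| + 1.
have cm : c < m by rewrite /m (le_lt_trans (ler_norm _))// -addrA ltrDl ltr_wpDl.
have dm : d < m by rewrite /m (le_lt_trans (ler_norm _))// -addrA addrCA ltrDl ltr_wpDl.
have m0 : 0 <= m by rewrite /m !addr_ge0.
rewrite (@Rintegral_compact_support _ _ m) => [|x mx]; last first.
  by apply: fc; exact: lt_trans mx.
rewrite fF.2; last by lra.
by rewrite !Fd ?subrr// ?normrN ger0_norm.
Qed.

(** The product of a step rising on [-c - 1, -c] and a step falling on [c, c + 1]. *)
Lemma cutoff c : exists chi : R -> R, [/\ smooth chi,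
  forall x, `|x| <= c -> chi x = 1, forall x, c + 1 <= `|x| -> chi x = 0 &
  forall x, 0 <= chi x <= 1].
Proof.
have [theta [st t0 t1 tm t01]] := @smooth_step R.
exists (fun x => theta (1 * x + (c + 1)) * theta (-1 * x + (c + 1))); split.
- by apply: smoothM; exact: smooth_affine.
- by move=> x; rewrite ler_norml => /andP[cx xc]; rewrite !t1 ?mulr1//; lra.
- move=> x; rewrite ler_normr => /orP[cx|cx].
    by rewrite (t0 (-1 * x + _)) ?mulr0//; lra.
  by rewrite (t0 (1 * x + _)) ?mul0r//; lra.
- move=> x; have /andP[a0 a1] := t01 (1 * x + (c + 1)).
  have /andP[b0 b1] := t01 (-1 * x + (c + 1)).
  by rewrite mulr_ge0//= mulr_ile1.
Qed.

(** Only [x] is confined to the segment, because the nodes at which the approximation below samples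
    its function may lie slightly outside. *)
Lemma segment_uniform_continuity f a b e : continuous f -> 0 < e ->
  exists2 d, 0 < d & forall x y, x \in `[a, b] -> `|y - x| < d -> `|f y - f x| < e.
Proof.
move=> cf e0.
have e2 : 0 < e / 2 by rewrite divr_gt0.
have /compact_near_coveringP/(_ R (0 : R)^'+
  (fun d x => forall y, `|y - x| < d -> `|f y - f x| < e)) := @segment_compact R a b.
move=> /(_ _ _)[|d /= d0 Hd].
  move=> x _; move: (cf x) => /cvgrPdist_lt/(_ _ e2)[d /= d0 Hd].
  have d2 : 0 < d / 2 by rewrite divr_gt0.
  near=> x' h => y yx'.
  have xx' : `|x - x'| < d / 2 by near: x'; exact: cvgr_dist_lt.
  have hd : h < d / 2 by near: h; exact: nbhs_right_lt.
  have h1 : `|f x - f x'| < e / 2 by apply: Hd; rewrite /ball_/=; lra.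
  have h2 : `|f x - f y| < e / 2.
    apply: Hd; rewrite /ball_/= (_ : x - y = (x - x') - (y - x')); last by ring.
    by rewrite (le_lt_trans (ler_normB _ _))// [ltRHS]splitr ltrD// (lt_trans yx').
  rewrite (_ : f y - f x' = (f x - f x') - (f x - f y)); last by ring.
  by rewrite (le_lt_trans (ler_normB _ _))// [ltRHS]splitr ltrD.
have d2 : 0 < d / 2 by rewrite divr_gt0.
exists (d / 2) => // x y xab xy; apply: (Hd (d / 2)) => //.
by rewrite /ball_/= sub0r normrN gtr0_norm//; lra.
Unshelve. all: by end_near. Qed.

(* Smoothed step functions: the weights theta((x - p i)/h) - theta((x - p i.+1)/h)
   are nonnegative, add up to 1 on [-c, c] and live within 2 h of p i. *)
Lemma smooth_uniform_approximation g c e : continuous g -> 0 < e ->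
  exists2 q, smooth q & forall x, `|x| <= c -> `|q x - g x| <= e.
Proof.
move=> cg e0.
have [theta [st t0 t1 tm _]] := @smooth_step R.
have [d d0 gd] := segment_uniform_continuity (- c) c cg e0.
pose h := d / 2; have h0 : 0 < h by rewrite divr_gt0.
(* The first node is one step left of - c, so that [T 0] already equals 1 on [-c, c]; [K] below is
   large enough for [T K] to vanish there. The sum of the weights telescopes to 1. *)
pose p (i : nat) : R := - c - h + i%:R * h.
have pS i : p i.+1 = p i + h by rewrite /p -natr1; ring.
pose T i x := theta (h^-1 * x + - (h^-1 * p i)).
have TE i x : T i x = theta ((x - p i) / h) by rewrite /T; congr theta; ring.
have T0 i x : x <= p i -> T i x = 0.
  by move=> xp; rewrite TE t0// pmulr_lle0 ?invr_gt0// subr_le0.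
have T1 i x : p i + h <= x -> T i x = 1.
  by move=> xp; rewrite TE t1// ler_pdivlMr// mul1r lerBrDl.
have Tm i x : T i.+1 x <= T i x.
  rewrite !TE; apply: tm; rewrite ler_pM2r ?invr_gt0// pS; lra.
pose K := Num.bound ((2 * c + h) / h).
have pK : c <= p K.
  have : (2 * c + h) / h < K%:R.
    have [n0|n0] := leP 0 ((2 * c + h) / h); first exact: archi_boundP.
    exact: lt_le_trans n0 _.
  by rewrite ltr_pdivrMr// /p; lra.
exists (fun x => \sum_(0 <= i < K) g (p i) * (T i x + -1 * T i.+1 x)).
  apply: smooth_sum => i; apply: smoothZ; apply: smoothD; first exact: smooth_affine.
  by apply: smoothZ; exact: smooth_affine.
move=> x xc; have xI : x \in `[- c, c] by rewrite in_itv/= -ler_norml.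
have /andP[cx xc'] := xI.
have S1 : \sum_(0 <= i < K) (T i x - T i.+1 x) = 1.
  rewrite -[LHS]opprK -sumrN.
  under eq_bigr do rewrite opprB.
  rewrite telescope_sumr// opprB T1 ?T0 ?subr0//; first exact: le_trans pK.
  by rewrite /p mul0r addr0 subrK.
under eq_bigr do rewrite mulN1r.
rewrite -[X in _ - X]mulr1 -S1 mulr_sumr -sumrB (le_trans (ler_norm_sum _ _ _))//.
rewrite -[leRHS]mulr1 -S1 mulr_sumr; apply: ler_sum => i _.
rewrite -mulrBl normrM (ger0_norm (x := T i x - _)) ?subr_ge0//.
have [xp|px] := leP x (p i).
  by rewrite T0// T0 ?subrr ?mulr0// pS; lra.
have [xp|px'] := leP (p i.+1 + h) x.
  by rewrite (T1 _ _ xp) T1 ?subrr ?mulr0//; rewrite pS in xp; lra.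
apply: ler_wpM2r; first by rewrite subr_ge0.
apply/ltW/gd => //; rewrite pS in px'; rewrite ltr_norml; apply/andP; split; rewrite /h in px'; lra.
Qed.

End approximation.

(** * Extension of the form bounds to C^1 functions of compact support *)

Section test_functions.
Set Implicit Arguments. Unset Strict Implicit.
Context {R : realType}.
Notation mu := (@lebesgue_measure R).
Implicit Types (f g F G phi eta : R -> R) (a b c x : R).

Lemma continuousX f n : continuous f -> continuous (fun x => f x ^+ n).
Proof.
move=> cf x; apply: (@continuous_comp _ _ _ f (fun y => y ^+ n)); first exact: cf.
exact: exprn_continuous.
Qed.

Lemma continuous_normr f : continuous f -> continuous (fun x => `|f x|).
Proof. by move=> cf x; apply: continuous_comp; [exact: cf|exact: norm_continuous]. Qed.

(** A smooth [q] close to [eta'] is integrated from a point left of the support of [eta], and the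
    cutoff [chi] restores compact support. As [chi] is 1 on the support, [eta] is [chi * eta], so
    the derivative error is chi (q - eta') + chi' (P - eta). *)
Lemma C1_smooth_approximation eta eta' M e : 0 <= M -> has_derivative eta eta' ->
  continuous eta' -> (forall x, M < `|x| -> eta x = 0) -> 0 < e ->
  exists phi, [/\ smooth phi, forall x, M + 1 < `|x| -> phi x = 0,
    forall x, `|phi x - eta x| <= e & forall x, `|phi^`()%classic x - eta' x| <= e].
Proof.
move=> M0 deta ceta' etaM e0.
have eta'M := derivative_support deta etaM.
have [chi [schi chi1 chi0 chi01]] := cutoff M.
pose L := M + 1; have L0 : 0 < L by rewrite /L; lra.
have dchi := smooth_has_derivative schi; set chi' := chi^`()%classic in dchi.
have cchi' : continuous chi' by apply: smooth_continuous; exact: smooth_derive.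
have [B [B0 chi'B]] := continuous_bounded_segment (- L) L cchi'.
(* If [q] is within d of [eta'], then [P] is within 2 L d of [eta]. The first two terms of [C] bound
   the derivative error, the last one the error of the values. *)
pose C := B * (2 * L) + 1 + 2 * L.
have C0 : 0 < C by rewrite /C !addr_gt0 ?mulr_gt0.
pose d := e / C; have d0 : 0 < d by rewrite divr_gt0.
have [q sq qeta] := smooth_uniform_approximation L ceta' d0.
have cq := smooth_continuous sq.
have PP := primitiveP (continuous_L1loc cq).
pose P x := - primitive q (- L) + primitive q x.
have qP : is_primitive q P by exact: is_primitive_shift.
have dP : has_derivative P q by move=> x; apply: (is_primitive_derive qP); exact: cq.
have sP : smooth P := smooth_antiderivative dP sq.
have etaL : eta (- L) = 0 by apply: etaM; rewrite normrN gtr0_norm// /L; lra.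
have Peta x : `|x| <= L -> `|P x - eta x| <= 2 * L * d.
  rewrite ler_norml => /andP[Lx xL].
  have := is_primitive_norm_le (is_primitiveB qP (has_derivative_primitive ceta' deta))
    (is_primitive_cst d) Lx.
  rewrite /P etaL addNr !subr0 => /(_ _)/le_trans; apply.
    move=> y; rewrite in_itv/= => /andP[Ly yx]; apply: qeta.
    by rewrite ler_norml Ly (le_trans yx).
  by rewrite -mulrBr mulrC ler_pM2r//; lra.
have chieta x : chi x * eta x = eta x.
  have [/chi1 ->|/etaM ->] := leP `|x| M; first by rewrite mul1r.
  by rewrite mulr0.
have chieta' x : chi x * eta' x + eta x * chi' x = eta' x.
  have := has_derivativeE (has_derivativeM dchi deta).
  rewrite (_ : (fun x => chi x * eta x) = eta); last exact/funext.
  by rewrite (has_derivativeE deta) => /(congr1 (@^~ x)).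
have chi0' x : L < `|x| -> chi x = 0 by move=> /ltW; exact: chi0.
have chi'0 := derivative_support dchi chi0'.
have de : C * d = e by rewrite mulrC divfK// gt_eqF.
exists (fun x => chi x * P x); split.
- exact: smoothM.
- by move=> x /chi0' ->; rewrite mul0r.
- move=> x; rewrite -[X in _ - X]chieta -mulrBr normrM.
  have [/Peta xL|/chi0' ->] := leP `|x| L; last by rewrite normr0 mul0r ltW.
  have /andP[c0 c1] := chi01 x.
  apply: (@le_trans _ _ (2 * L * d)).
    by rewrite -[leRHS]mul1r ler_pM// ger0_norm.
  by rewrite -de ler_pM2r// /C; have := mulr_ge0 (ltW B0) (ltW L0); lra.
- move=> x; rewrite (has_derivativeE (has_derivativeM dchi dP)) -[X in _ - X]chieta'.
  have -> : chi x * q x + P x * chi' x - (chi x * eta' x + eta x * chi' x) =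
    chi x * (q x - eta' x) + chi' x * (P x - eta x) by ring.
  rewrite (le_trans (ler_normD _ _))// !normrM.
  have [xL|xL] := leP `|x| L; last first.
    by rewrite chi0'// chi'0// normr0 !mul0r addr0 ltW.
  have /andP[c0 c1] := chi01 x.
  have h1 : `|chi x| * `|q x - eta' x| <= d.
    by rewrite -[leRHS]mul1r ler_pM// ?qeta// ger0_norm.
  have h2 : `|chi' x| * `|P x - eta x| <= B * (2 * L * d).
    by apply: ler_pM => //; [apply: chi'B; rewrite in_itv/= -ler_norml|exact: Peta].
  rewrite -de /C !mulrDl mul1r -!mulrA in h2 *.
  have : 0 <= 2 * (L * d) by rewrite mulr_ge0// mulr_ge0 ?ltW.
  lra.
Qed.

(** If [phi] and its derivative are within e <= 1 of [eta] and [eta'], the integrands of the two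
    forms differ by at most e v, where [v] is locally integrable and does not depend on [phi]. Since
    the supports stay in one segment, e can tend to 0. *)
Lemma form_lower_bound_C1 (W : R -> R) (E : R) eta eta' : L1loc W ->
  form_bounded_below W E -> has_derivative eta eta' -> continuous eta' ->
  compact_support eta -> 0 <= \int[mu]_x (eta' x ^+ 2 + (W x - E) * eta x ^+ 2).
Proof.
move=> LW WE deta ceta' [M0 etaM0].
pose M : R := `|M0|; have M_ge0 : 0 <= M by exact: normr_ge0.
have etaM x : M < `|x| -> eta x = 0.
  by move=> Mx; apply: etaM0; exact: le_lt_trans (ler_norm _) Mx.
have eta'M := derivative_support deta etaM.
have ceta := has_derivative_continuous deta.
pose q (u v : R -> R) x := v x ^+ 2 + (W x - E) * u x ^+ 2.
have LWE : L1loc (fun x => W x - E).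
  by apply: L1locB => //; apply: continuous_L1loc => x; exact: cvg_cst.
have Lq u v : continuous u -> continuous v -> L1loc (q u v).
  move=> cu cv; apply: L1locD; first by apply: continuous_L1loc; exact: continuousX.
  by apply: L1locM => //; exact: continuousX.
have q_ge0 phi : smooth_compact phi -> 0 <= \int[mu]_x q phi phi^`()%classic x.
  move=> [sphi phi0]; have := WE _ (conj sphi phi0); rewrite -subr_ge0.
  have cphi := smooth_continuous sphi.
  have cphi' := smooth_continuous (smooth_derive sphi).
  have phi'0 : compact_support phi^`()%classic.
    have [m phim] := phi0; exists m.
    exact: derivative_support (smooth_has_derivative sphi) phim.
  have L2 : L1loc (fun x => phi x ^+ 2) by apply: continuous_L1loc; exact: continuousX.
  have i2 := compact_support_integrable L2 (compact_supportX 1 phi0).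
  rewrite /qform /l2norm2 -RintegralZl// -RintegralB//; last 2 first.
  - apply: compact_support_integrable.
      apply: L1locD; first by apply: continuous_L1loc; exact: continuousX.
      by apply: L1locM => //; exact: continuousX.
    apply: compact_supportD; first exact: compact_supportX.
    by apply: (@compact_supportMr R W (fun x => phi x ^+ 2)); exact: compact_supportX.
  - apply: compact_support_integrable; first exact: L1locZ.
    by apply: (@compact_supportMr R (cst E) (fun x => phi x ^+ 2)); exact: compact_supportX.
  by move/le_trans; apply; rewrite le_eqVlt; apply/orP; left; apply/eqP;
    apply: eq_Rintegral => x _; rewrite /q; ring.
pose L := M + 1.
have qL u v : (forall x, L < `|x| -> u x = 0) -> (forall x, L < `|x| -> v x = 0) ->
    \int[mu]_x q u v x = \int[mu]_(x in `[- L, L]) q u v x.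
  move=> u0 v0; apply: Rintegral_compact_support => x Lx.
  by rewrite /q u0// v0// expr0n/= mulr0 addr0.
pose v x := 2 * `|eta' x| + 1 + `|W x - E| * (2 * `|eta x| + 1).
have Lv : L1loc v.
  have caff f : continuous f -> continuous (fun x => 2 * `|f x| + 1).
    move=> cf x; apply: cvgD; last exact: cvg_cst.
    by apply: cvgM; [exact: cvg_cst|exact: continuous_normr].
  apply: L1locD; first by apply: continuous_L1loc; exact: caff.
  by apply: L1locM; [exact: L1loc_normr|exact: caff].
set C := \int[mu]_(x in `[- L, L]) v x.
have C0 : 0 <= C.
  by apply: Rintegral_ge0 => x _; rewrite /v addr_ge0 ?mulr_ge0 ?addr_ge0 ?mulr_ge0.
have lower e : 0 < e -> e <= 1 -> - (e * C) <= \int[mu]_x q eta eta' x.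
  move=> e0 e1.
  have [phi [sphi phiL phie phi'e]] := C1_smooth_approximation M_ge0 deta ceta' etaM e0.
  have cphi := smooth_continuous sphi.
  have cphi' := smooth_continuous (smooth_derive sphi).
  have phi'L := derivative_support (smooth_has_derivative sphi) phiL.
  have := q_ge0 phi (conj sphi (ex_intro _ _ phiL)).
  rewrite qL// qL; last 2 first.
  - by move=> x Lx; apply: etaM; rewrite (lt_trans _ Lx)// /L ltrDl.
  - by move=> x Lx; apply: eta'M; rewrite (lt_trans _ Lx)// /L ltrDl.
  move=> h; rewrite lerNl -subr_ge0 opprK /C.
  rewrite -RintegralZl//; last exact: L1loc_integrable.
  rewrite -RintegralD//; [|by apply: L1loc_integrable; first [exact: L1locZ|exact: Lq]..].
  apply: (le_trans h); apply: le_Rintegral => //.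
  - by apply: L1loc_integrable; exact: Lq.
  - by apply: L1loc_integrable; apply: L1locD; [exact: L1locZ|exact: Lq].
  move=> x _; rewrite -lerBlDr /q /v.
  have sq (s t : R) : `|s - t| <= e -> `|s ^+ 2 - t ^+ 2| <= e * (2 * `|t| + 1).
    move=> st; rewrite subr_sqr normrM ler_pM//.
    rewrite (_ : s + t = (s - t) + (t + t)); last by ring.
    rewrite (le_trans (ler_normD _ _))// (le_trans (lerD (le_trans st e1) (ler_normD _ _)))//.
    by rewrite addrC mulr2n mulrDl !mul1r.
  have h1 := sq _ _ (phi'e x).
  have h2 := sq _ _ (phie x).
  rewrite (_ : _ - _ = (phi^`()%classic x ^+ 2 - eta' x ^+ 2) +
    (W x - E) * (phi x ^+ 2 - eta x ^+ 2)); last by ring.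
  rewrite [leRHS]mulrDr; apply: lerD; first exact: le_trans (ler_norm _) h1.
  rewrite (le_trans (ler_norm _))// normrM mulrCA.
  by apply: ler_wpM2l.
rewrite -/(q eta eta') leNgt; apply/negP => neg.
set J := Rintegral _ _ _ in lower neg.
(* Chosen so that e C < - J, against [lower]; the summand 1 keeps the denominator positive when [C]
   is 0. *)
pose e := Num.min 1 (- J / (2 * (C + 1))).
have C1 : 0 < 2 * (C + 1) by rewrite mulr_gt0// ltr_wpDl.
have e0 : 0 < e by rewrite lt_min ltr01 divr_gt0// oppr_gt0.
have e1 : e <= 1 by rewrite ge_min lexx.
have := lower e e0 e1.
have : e * (2 * (C + 1)) <= - J by rewrite -ler_pdivlMr// ge_min lexx orbT.
have : 0 <= e * C by rewrite mulr_ge0// ltW.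
move: e0 neg; lra.
Qed.

End test_functions.

(** * Distributional equations *)

Section weak_solutions.
Set Implicit Arguments. Unset Strict Implicit.
Context {R : realType}.
Notation mu := (@lebesgue_measure R).
Implicit Types (f g F G phi psi eta q W : R -> R) (a b c x E : R).

Lemma ae_witness (P : R -> Prop) a b : a < b -> {ae mu, forall x, P x} ->
  exists2 x, a < x < b & P x.
Proof.
move=> ab [N [mN N0 PN]]; apply: contrapT => nP.
have abN : `]a, b[ `<=` N.
  by move=> x /=; rewrite in_itv/= => xab; apply: PN => Px; apply: nP; exists x.
have : (mu `]a, b[ <= mu N)%E by apply: le_measure => //; rewrite inE.
rewrite N0 lebesgue_measure_itv/= lte_fin ab -EFinD lee_fin.
by rewrite leNgt subr_gt0 ab.
Qed.

Lemma is_primitive_const f F a b : is_primitive f F -> a <= b ->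
  (forall x, x \in `[a, b] -> f x = 0) -> F b = F a.
Proof.
move=> fF ab f0; apply/eqP; rewrite -subr_eq0 -normr_le0.
have := is_primitive_norm_le fF (is_primitive_cst 0) ab.
by rewrite !mul0r subrr; apply=> x /f0 ->; rewrite normr0.
Qed.

Lemma L1loc_test_integrable f g : L1loc f -> continuous g -> compact_support g ->
  mu.-integrable setT (EFin \o (fun x => f x * g x)).
Proof.
move=> Lf cg g0; apply: compact_support_integrable; first exact: L1locM.
exact: compact_supportMr.
Qed.

(** The test function is a smoothed indicator of [a, b]. Replacing the indicator by it costs at most
    the integral of |f| over two end pieces of length [d], which is small by continuity of the
    primitive of |f|. So f integrates to 0 over every segment. *)
Lemma fundamental_lemma_variations f : L1loc f ->
  (forall phi, smooth_compact phi -> \int[mu]_x (f x * phi x) = 0) ->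
  {ae mu, forall x, f x = 0}.
Proof.
move=> Lf f0; apply: is_primitive0_ae; split=> // a b.
rewrite /= subrr le_eqVlt => /predU1P[->|ab].
  by rewrite set_itv1 Rintegral_set1.
have [theta [st t0 t1 tm t01]] := @smooth_step R.
have AP := primitiveP (L1loc_normr Lf); set A := primitive _ in AP.
have cA := is_primitive_continuous AP.
have fP := primitiveP Lf; set P := primitive f in fP.
rewrite fP.2 ?ltW//; apply/eqP; rewrite -normr_le0; apply/ler_addgt0Pl => e e0.
rewrite addr0.
have e2 : 0 < e / 2 by rewrite divr_gt0.
have [d [d0 dab dA]] : exists d, [/\ 0 < d, a + d <= b - d &
    A (a + d) - A a <= e / 2 /\ A b - A (b - d) <= e / 2].
  have /cvgrPdist_lt/(_ _ e2)[d1 /= d10 H1] := cA a.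
  have /cvgrPdist_lt/(_ _ e2)[d2 /= d20 H2] := cA b.
  pose d := Num.min (d1 / 2) (Num.min (d2 / 2) ((b - a) / 2)).
  have d0 : 0 < d by rewrite !lt_min !divr_gt0 ?subr_gt0.
  have dd1 : d <= d1 / 2 by rewrite ge_min lexx.
  have dd2 : d <= d2 / 2 by rewrite !ge_min lexx orbT.
  have dd3 : d <= (b - a) / 2 by rewrite !ge_min lexx !orbT.
  exists d; split=> //; first by lra.
  split.
    have /H1 : ball_ [eta Num.Def.normr] a d1 (a + d).
      by rewrite /ball_/= opprD addNKr normrN gtr0_norm//; lra.
    by rewrite distrC => /ltW; exact/le_trans/ler_norm.
  have /H2 : ball_ [eta Num.Def.normr] b d2 (b - d).
    by rewrite /ball_/= opprB addrC subrK gtr0_norm//; lra.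
  by move/ltW; exact/le_trans/ler_norm.
pose phi x := theta (d^-1 * x + - (d^-1 * a)) * theta (- d^-1 * x + d^-1 * b).
have phiE x : phi x = theta ((x - a) / d) * theta ((b - x) / d).
  by rewrite /phi; congr (theta _ * theta _); ring.
have sphi : smooth phi by apply: smoothM; exact: smooth_affine.
have cphi := smooth_continuous sphi.
have phi01 x : 0 <= phi x <= 1.
  rewrite phiE; have /andP[? ?] := t01 ((x - a) / d).
  by have /andP[? ?] := t01 ((b - x) / d); rewrite mulr_ge0//= mulr_ile1.
have phia x : x <= a -> phi x = 0.
  by move=> xa; rewrite phiE t0 ?mul0r// pmulr_lle0 ?invr_gt0// subr_le0.
have phib x : b <= x -> phi x = 0.
  by move=> bx; rewrite phiE mulrC t0 ?mul0r// pmulr_lle0 ?invr_gt0// subr_le0.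
have phi1 x : a + d <= x -> x <= b - d -> phi x = 1.
  by move=> ax xb; rewrite phiE !t1 ?mulr1// ler_pdivlMr//; lra.
pose m := `|a| + `|b|.
have phi0 x : m < `|x| -> phi x = 0.
  rewrite lter_normr => /orP[mx|mx].
    apply: phib; apply: ltW; apply: le_lt_trans mx.
    by rewrite /m (le_trans (ler_norm _))// lerDr.
  apply: phia; apply: ltW; rewrite -ltrN2; apply: le_lt_trans mx.
  by rewrite /m (le_trans (ler_norm _))// normrN lerDl.
have Lfphi : L1loc (fun x => f x * phi x) by exact: L1locM.
have HP := primitiveP Lfphi; set H := primitive _ in HP.
have Hab : H b - H a = 0.
  rewrite -(f0 phi); last by split=> //; exists m.
  have am : - m <= a by rewrite /m -[leRHS]opprK lerN2 (le_trans (ler_norm _))// normrN lerDl.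
  have bm : b <= m by rewrite /m (le_trans (ler_norm _))// lerDr.
  rewrite (@Rintegral_compact_support R _ m); last by move=> x /phi0 ->; rewrite mulr0.
  rewrite HP.2; last by lra.
  rewrite (is_primitive_const HP bm); last first.
    by move=> x; rewrite in_itv/= => /andP[/phib -> _]; rewrite mulr0.
  rewrite (is_primitive_const HP am)//.
  by move=> x; rewrite in_itv/= => /andP[_ /phia ->]; rewrite mulr0.
have UP := is_primitiveB fP HP.
rewrite -(subr0 (P b - P a)) -Hab.
(* [P - H] is a primitive of f (1 - phi): it is constant on [a + d, b - d], so only the two end
   pieces contribute. *)
have le1 x y : x <= y -> `|(P y - H y) - (P x - H x)| <= A y - A x.
  move=> xy; apply: (is_primitive_norm_le UP AP xy) => t _.
  rewrite -{1}[f t]mulr1 -mulrBr normrM -[leRHS]mulr1 ler_wpM2l//.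
  by have /andP[? ?] := phi01 t; rewrite ger0_norm; lra.
have eq0 : P (b - d) - H (b - d) = P (a + d) - H (a + d).
  apply: (is_primitive_const UP dab) => x; rewrite in_itv/= => /andP[ax xb].
  by rewrite phi1// mulr1 subrr.
have l1 := le1 a (a + d); have l2 := le1 (b - d) b.
have {l1}l1 : `|(P (a + d) - H (a + d)) - (P a - H a)| <= e / 2.
  by apply: (le_trans (l1 _)); [lra|exact: dA.1].
have {l2}l2 : `|(P b - H b) - (P (b - d) - H (b - d))| <= e / 2.
  by apply: (le_trans (l2 _)); [lra|exact: dA.2].
rewrite (_ : _ - _ = ((P b - H b) - (P (b - d) - H (b - d))) +
  ((P (a + d) - H (a + d)) - (P a - H a))); last by rewrite eq0; ring.
by rewrite [leRHS]splitr (le_trans (ler_normD _ _))// lerD.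
Qed.

(** A primitive of [h] is constant on each side of the support; mean zero makes the two constants
    agree, and subtracting their common value [K] leaves a compactly supported function. *)
Lemma smooth_compact_antiderivative h : smooth_compact h -> \int[mu]_x h x = 0 ->
  exists2 phi, smooth_compact phi & has_derivative phi h.
Proof.
move=> [sh [m0 hm0]] h0; pose m : R := `|m0|.
have m_ge0 : 0 <= m by exact: normr_ge0.
have hm x : m < `|x| -> h x = 0.
  by move=> mx; apply: hm0; exact: le_lt_trans (ler_norm _) mx.
have ch := smooth_continuous sh.
have hP := primitiveP (continuous_L1loc ch); set P := primitive h in hP.
pose K := P (- (m + 1)).
have PN x : x < - m -> P x = K.
  move=> xm; have [xm1|/ltW xm1] := leP x (- (m + 1)).
    apply/esym; apply: (is_primitive_const hP xm1) => t; rewrite in_itv/= => /andP[xt tm].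
    by apply: hm; rewrite lter_normr; apply/orP; right; lra.
  apply: (is_primitive_const hP xm1) => t; rewrite in_itv/= => /andP[xt tm].
  by apply: hm; rewrite lter_normr; apply/orP; right; lra.
have PP x : m < x -> P x = K.
  move=> mx; rewrite -(PN (- x)) ?ltrN2//; apply/eqP; rewrite -subr_eq0 -hP.2; last by lra.
  rewrite -(@Rintegral_compact_support R h x) ?h0// => y xy.
  by apply: hm; exact: lt_trans xy.
have dP : has_derivative (fun x => - K + P x) h.
  by move=> x; apply: (is_primitive_derive (is_primitive_shift (- K) hP)); exact: ch.
exists (fun x => - K + P x); last exact: dP.
split; first exact: (smooth_antiderivative dP sh).
by exists m => x; rewrite lter_normr ltrNr => /orP[/PP|/PN] ->; rewrite addNr.
Qed.

Lemma smooth_unit_mass : exists2 rho : R -> R, smooth_compact rho & \int[mu]_x rho x = 1.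
Proof.
have [chi [schi chi1 chi0 chi01]] := @cutoff R 1.
have cchi := smooth_continuous schi.
have chi02 x : 2 < `|x| -> chi x = 0 by move=> x2; apply: chi0; lra.
have CP := primitiveP (continuous_L1loc cchi); set C := primitive chi in CP.
set I := \int[mu]_x chi x.
have I0 : 0 < I.
  rewrite /I (Rintegral_compact_support chi02) CP.2; last by lra.
  have mono a b : a <= b -> 0 <= C b - C a.
    by move=> ab; rewrite -CP.2//; apply: Rintegral_ge0 => x _; case/andP: (chi01 x).
  have h1 := mono (- 2) (- 1); have h2 := mono 1 2.
  have : 1 * 1 - 1 * (- 1) <= C 1 - C (- 1).
    apply: (is_primitive_le (is_primitive_cst 1) CP); first by lra.
    by move=> x; rewrite in_itv/= -ler_norml => /chi1 ->.
  have {h1} := h1 _; have {h2} := h2 _; lra.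
exists (fun x => I^-1 * chi x).
  split; first exact: smoothZ.
  by exists 2 => x /chi02 ->; rewrite mulr0.
rewrite RintegralZl//; first by rewrite mulVf// gt_eqF.
by apply: compact_support_integrable; [exact: continuous_L1loc|exists 2].
Qed.

(** Subtracting a multiple of a fixed unit mass turns any test function into the derivative of one.
    This is how arbitrary test functions reach the hypotheses of the two du Bois-Reymond lemmas. *)
Lemma smooth_mean_free_antiderivative rho h :
  smooth_compact rho -> \int[mu]_x rho x = 1 -> smooth_compact h ->
  exists2 phi, smooth_compact phi &
    has_derivative phi (fun x => h x + - (\int[mu]_x h x) * rho x).
Proof.
move=> [srho rho0] rho1 [sh h0]; set a := \int[mu]_x h x.
have Lh := continuous_L1loc (smooth_continuous sh).
have Lrho := continuous_L1loc (smooth_continuous srho).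
have ih := compact_support_integrable Lh h0.
have irho := compact_support_integrable Lrho rho0.
have iarho := compact_support_integrable (L1locZ a Lrho)
  (compact_supportMr (fun=> a) rho0).
apply: smooth_compact_antiderivative.
  by split; [exact: (@smoothD R h (fun x => - a * rho x) sh (@smoothZ R rho (- a) srho))|
    exact: (compact_supportD h0 (compact_supportMr (fun=> - a) rho0))].
rewrite (_ : (fun x => h x + - a * rho x) = (fun x => h x - a * rho x)); last first.
  by apply/funext => x; rewrite mulNr.
by rewrite RintegralB// RintegralZl// rho1 mulr1 subrr.
Qed.

(** Testing with the [phi] for which phi' = h - (int h) rho gives int f h = c int h, where c = int f
    rho. *)
Lemma du_bois_reymond f : L1loc f ->
  (forall phi, smooth_compact phi -> \int[mu]_x (f x * phi^`()%classic x) = 0) ->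
  exists c, {ae mu, forall x, f x = c}.
Proof.
move=> Lf f0; have [rho [srho rho0] rho1] := smooth_unit_mass.
have crho := smooth_continuous srho.
exists (\int[mu]_x (f x * rho x)); set c := Rintegral _ _ _.
have Lc : L1loc (cst c : R -> R) by apply: continuous_L1loc => x; exact: cvg_cst.
suff : {ae mu, forall x, f x - c = 0}.
  by apply: (@filterS _ _ (ae_filter_ringOfSetsType mu)) => x /eqP; rewrite subr_eq0 => /eqP.
apply: fundamental_lemma_variations; first exact: (L1locB Lf Lc).
move=> h [sh h0]; have ch := smooth_continuous sh.
pose a := \int[mu]_x h x.
have ih : mu.-integrable setT (EFin \o h).
  by apply: compact_support_integrable => //; exact: continuous_L1loc.
have [phi sphi dphi] := smooth_mean_free_antiderivative (conj srho rho0) rho1 (conj sh h0).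
rewrite -/a in dphi.
have := f0 phi sphi; rewrite (has_derivativeE dphi).
have i1 := L1loc_test_integrable Lf ch h0.
have i2 := L1loc_test_integrable (L1locZ a Lf) crho rho0.
have -> : \int[mu]_x (f x * (h x + - a * rho x)) =
    \int[mu]_x (f x * h x) - a * c.
  rewrite -RintegralZl//; last exact: L1loc_test_integrable.
  rewrite -RintegralB//; first by apply: eq_Rintegral => x _; ring.
  by under eq_fun do rewrite mulrA.
move=> /eqP; rewrite subr_eq0 => /eqP fh.
transitivity (\int[mu]_x (f x * h x - c * h x)).
  by apply: eq_Rintegral => x _; ring.
rewrite RintegralB ?RintegralZl//; first by rewrite fh -/a; ring.
by have := L1loc_test_integrable Lc ch h0.
Qed.

(** Reduction to first order. With a = int h, b = int f rho' and phi' = h - a rho, the hypothesis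
    reads int f h' = a b, whereas int x h' = - a by parts. Hence f + b x is orthogonal to every
    h'. *)
Lemma du_bois_reymond2 f : L1loc f ->
  (forall phi, smooth_compact phi -> \int[mu]_x (f x * derive1n 2 phi x) = 0) ->
  exists c d, {ae mu, forall x, f x = c + d * x}.
Proof.
move=> Lf f0; have [rho [srho rho0] rho1] := smooth_unit_mass.
have crho := smooth_continuous srho.
have drho := smooth_has_derivative srho.
have crho' := smooth_continuous (smooth_derive srho).
have rho'0 : compact_support rho^`()%classic.
  by have [m rhom] := rho0; exists m; exact: derivative_support drho rhom.
pose b := \int[mu]_x (f x * rho^`()%classic x).
have cid : continuous (id : R -> R) by move=> x; exact: cvg_id.
have Lx : L1loc (fun x => b * x) by exact/L1locZ/continuous_L1loc.
have [||c fc] := @du_bois_reymond (fun x => f x + b * x).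
- exact: L1locD.
- move=> h [sh h0]; have ch := smooth_continuous sh.
  have dh := smooth_has_derivative sh.
  have ch' := smooth_continuous (smooth_derive sh).
  have h'0 : compact_support h^`()%classic.
    by have [m hm] := h0; exists m; exact: derivative_support dh hm.
  pose a := \int[mu]_x h x.
  have ih : mu.-integrable setT (EFin \o h).
    by apply: compact_support_integrable => //; exact: continuous_L1loc.
  have [phi sphi dphi] := smooth_mean_free_antiderivative (conj srho rho0) rho1 (conj sh h0).
  rewrite -/a in dphi.
  have := f0 phi sphi; rewrite /derive1n/= (has_derivativeE dphi).
  rewrite (has_derivativeE (has_derivativeD dh (has_derivativeZ (- a) drho))).
  have i1 := L1loc_test_integrable Lf ch' h'0.
  have i2 := L1loc_test_integrable (L1locZ a Lf) crho' rho'0.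
  have -> : \int[mu]_x (f x * (h^`()%classic x + - a * rho^`()%classic x)) =
      \int[mu]_x (f x * h^`()%classic x) - a * b.
    rewrite -RintegralZl//; last exact: L1loc_test_integrable.
    rewrite -RintegralB//; first by apply: eq_Rintegral => x _; ring.
    by under eq_fun do rewrite mulrA.
  move=> /eqP; rewrite subr_eq0 => /eqP fh.
  have ixh := L1loc_test_integrable (continuous_L1loc cid) ch' h'0.
  have xh : \int[mu]_x (x * h^`()%classic x) = - a.
    have c1 : continuous (cst 1 : R -> R) by move=> x; exact: cvg_cst.
    have := is_primitiveM (has_derivative_primitive ch' dh) (@has_derivative_id R) c1.
    move=> /compact_support_primitive -/(_ _ _) H.
    have : \int[mu]_x (x * h^`()%classic x + h x) = 0.
      rewrite -[RHS]H; first by apply: eq_Rintegral => x _; rewrite /=; ring.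
        apply: compact_supportD; exact: compact_supportMl.
      exact: compact_supportMl.
    by rewrite RintegralD// => /eqP; rewrite addr_eq0 => /eqP.
  transitivity (\int[mu]_x (f x * h^`()%classic x + b * (x * h^`()%classic x))).
    by apply: eq_Rintegral => x _; ring.
  rewrite RintegralD ?RintegralZl//; first by rewrite fh xh; ring.
  by have := L1loc_test_integrable Lx ch' h'0; under eq_fun do rewrite -mulrA.
exists c, (- b); move: fc.
by apply: (@filterS _ _ (ae_filter_ringOfSetsType mu)) => x <-; ring.
Qed.

End weak_solutions.

(** * Regularity and positivity of ground states *)

Section ground_states.
Set Implicit Arguments. Unset Strict Implicit.
Context {R : realType}.
Notation mu := (@lebesgue_measure R).
Implicit Types (f g F G phi psi Psi eta q W : R -> R) (a b c x E : R).

Lemma Rintegral_parts_test f F eta eta' : is_primitive f F ->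
  has_derivative eta eta' -> continuous eta' -> compact_support eta ->
  \int[mu]_x (f x * eta x) = - \int[mu]_x (F x * eta' x).
Proof.
move=> fF deta ceta' eta0; have Lf := fF.1.
have ceta := has_derivative_continuous deta.
have eta'0 : compact_support eta'.
  by have [m etam] := eta0; exists m; exact: derivative_support deta etam.
have LF := continuous_L1loc (is_primitive_continuous fF).
apply/eqP; rewrite -addr_eq0 -RintegralD//; last 2 first.
- exact: L1loc_test_integrable.
- exact: L1loc_test_integrable.
apply/eqP; apply: (compact_support_primitive (is_primitiveM fF deta ceta')).
- by apply: compact_supportD; exact: compact_supportMr.
- exact: compact_supportMr.
Qed.

(** Integrating k = (W - E) psi twice yields [G] with int G phi'' = int k phi = int psi phi''. So
    psi - G is affine almost everywhere. *)
Lemma weak_solution_regularity W E psi : L1loc W -> weak_solution W E psi ->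
  exists Psi Psi', [/\ {ae mu, forall x, psi x = Psi x}, has_derivative Psi Psi' &
    is_primitive (fun x => (W x - E) * Psi x) Psi'].
Proof.
move=> LW [Lpsi [LWpsi weak]].
pose k x := (W x - E) * psi x.
have Lk : L1loc k.
  rewrite (_ : k = fun x => W x * psi x - E * psi x).
    by apply: L1locB => //; exact: L1locZ.
  by apply/funext => x; rewrite /k; ring.
have kK := primitiveP Lk; set K := primitive k in kK.
have cK := is_primitive_continuous kK.
have KG := primitiveP (continuous_L1loc cK); set G := primitive K in KG.
have cG := is_primitive_continuous KG.
have LpG : L1loc (fun x => psi x - G x) by apply: L1locB => //; exact: continuous_L1loc.
have [|c [d psiE]] := @du_bois_reymond2 _ (fun x => psi x - G x) LpG.
  move=> phi sphi; have := weak phi sphi; have [sphi1 phi0] := sphi.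
  have dphi := smooth_has_derivative sphi1.
  have sphi' := smooth_derive sphi1.
  have dphi' := smooth_has_derivative sphi'.
  have cphi := smooth_continuous sphi1.
  have cphi' := smooth_continuous sphi'.
  have cphi'' := smooth_continuous (smooth_derive sphi').
  have phi'0 : compact_support phi^`()%classic.
    by have [m hm] := phi0; exists m; exact: derivative_support dphi hm.
  have phi''0 : compact_support phi^`()%classic^`()%classic.
    by have [m hm] := phi'0; exists m; exact: derivative_support dphi' hm.
  have i1 := L1loc_test_integrable Lpsi cphi'' phi''0.
  have i2 := L1loc_test_integrable Lk cphi phi0.
  have i3 := L1loc_test_integrable (continuous_L1loc cG) cphi'' phi''0.
  rewrite /derive1n/= => weak0.
  transitivity (\int[mu]_x (psi x * phi^`()^`()%classic x - G x * phi^`()^`()%classic x)).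
    by apply: eq_Rintegral => x _; ring.
  rewrite RintegralB//.
  have p2 := Rintegral_parts_test KG dphi' cphi'' phi'0.
  have p1 := Rintegral_parts_test kK dphi cphi' phi0.
  have -> : \int[mu]_x (G x * phi^`()^`()%classic x) = \int[mu]_x (k x * phi x).
    by rewrite p1 p2 opprK.
  rewrite -RintegralB// -[RHS]oppr0 -weak0 -mulN1r -RintegralZl//; last first.
    rewrite (_ : (fun x => _) = (fun x => k x * phi x - psi x * phi^`()^`()%classic x)).
      by have := integrableB _ i2 i1; apply.
    by apply/funext => x; rewrite /k; ring.
  by apply: eq_Rintegral => x _; rewrite /k; ring.
pose Psi x := c + (d * x + G x); pose Psi' x := d + K x.
have psiPsi : {ae mu, forall x, psi x = Psi x}.
  apply: (@filterS _ _ (ae_filter_ringOfSetsType mu)) psiE => x /eqP.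
  by rewrite subr_eq => /eqP ->; rewrite /Psi; ring.
have dPsi : has_derivative Psi Psi'.
  move=> x; have dG : is_derive x 1 G (K x) := is_primitive_derive KG (cK x).
  have := is_deriveD (is_derive_cst c x 1) (is_deriveD (has_derivativeZ d (@has_derivative_id R) x) dG).
  by rewrite add0r /= mulr1.
exists Psi, Psi'; split=> //.
have LWPsi : L1loc (fun x => (W x - E) * Psi x).
  apply: L1locM; last exact: has_derivative_continuous dPsi.
  by apply: L1locB => //; apply: continuous_L1loc => x; exact: cvg_cst.
(* [K] was built from psi and the claim is about [Psi]; the two integrands agree almost
   everywhere. *)
split=> // a b ab; rewrite /Psi' -(@Rintegral_ae_eq _ k).
- by rewrite kK.2//; ring.
- exact: Lk.1.
- exact: LWPsi.1.
- by apply: (@filterS _ _ (ae_filter_ringOfSetsType mu)) psiPsi => x; rewrite /k => ->.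
Qed.

(* At a zero x0 the derivative also vanishes, so on [x0, x0 + d] the maximum M of
   Psi satisfies M <= d M int |q| <= M / 2 for small d: Psi would vanish there. *)
Lemma solution_gt0 q psi Psi Psi' : L1loc q -> (forall x, 0 < psi x) ->
  {ae mu, forall x, psi x = Psi x} -> has_derivative Psi Psi' ->
  is_primitive (fun x => q x * Psi x) Psi' -> forall x, 0 < Psi x.
Proof.
move=> Lq psi0 psiPsi dPsi qPsi.
have cPsi := has_derivative_continuous dPsi.
(* If [Psi] were negative at a point, it would be so on an interval, and such an interval contains a
   point where it equals psi. *)
have Psi_ge0 x : 0 <= Psi x.
  rewrite leNgt; apply/negP => Px.
  have Px0 : 0 < - Psi x by rewrite oppr_gt0.
  have /cvgrPdist_lt/(_ _ Px0)[d /= d0 Hd] := cPsi x.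
  have xd : x < x + d by rewrite ltrDl.
  have [y /andP[xy yx] psiy] := ae_witness xd psiPsi.
  have : `|Psi x - Psi y| < - Psi x.
    by apply: Hd; rewrite /ball_/= distrC gtr0_norm ?subr_gt0// ltrBlDl.
  by rewrite -psiy ltr_norml => /andP[+ _]; have := psi0 y; lra.
move=> x0; rewrite lt_neqAle Psi_ge0 andbT eq_sym; apply/eqP => Px0.
(* By nonnegativity the zero [x0] is an interior minimum. *)
have P'x0 : Psi' x0 = 0.
  have x01 : x0 - 1 <= x0 + 1 by lra.
  have := @derive1_at_min R Psi (x0 - 1) (x0 + 1) x0 x01.
  move=> /(_ _ _ _)[|||_].
  - by move=> t _; exact: (@ex_derive _ _ _ _ _ _ _ (dPsi t)).
  - by rewrite in_itv/= ltrBlDr !ltrDl ltr01.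
  - by move=> t _; rewrite Px0.
  - by move=> <-; rewrite (@derive_val _ _ _ _ _ _ _ (dPsi x0)).
have AP := primitiveP (L1loc_normr Lq); set A := primitive _ in AP.
have cA := is_primitive_continuous AP.
have Amono a b : a <= b -> A a <= A b.
  by move=> ab; rewrite -subr_ge0 -(AP.2 _ _ ab); apply: Rintegral_ge0.
have [d [d0 d1 Ad]] : exists d, [/\ 0 < d, d <= 1 & A (x0 + d) - A x0 <= 1 / 2].
  have h0 : (0 : R) < 1 / 2 by rewrite divr_gt0.
  have /cvgrPdist_lt/(_ _ h0)[e /= e0 He] := cA x0.
  exists (Num.min 1 (e / 2)); split.
  - by rewrite lt_min ltr01 divr_gt0.
  - by rewrite ge_min lexx.
  have e2 : Num.min 1 (e / 2) <= e / 2 by rewrite ge_min lexx orbT.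
  have e20 : 0 < e / 2 by rewrite divr_gt0.
  have : A (x0 + Num.min 1 (e / 2)) <= A (x0 + e / 2) by apply: Amono; rewrite lerD2l.
  have : `|A x0 - A (x0 + e / 2)| < 1 / 2.
    by apply: He; rewrite /ball_/= opprD addNKr normrN gtr0_norm//; lra.
  by rewrite ltr_norml => /andP[+ _]; lra.
have x0d : x0 <= x0 + d by rewrite lerDl ltW.
have [c] := EVT_max x0d (continuous_subspaceT cPsi).
rewrite in_itv/= => /andP[x0c cd] cmax; set M := Psi c in cmax.
have M0 : 0 <= M by exact: Psi_ge0.
have P'M t : x0 <= t -> t <= x0 + d -> `|Psi' t| <= M / 2.
  move=> x0t td; rewrite -[Psi' t]subr0 -P'x0.
  have := is_primitive_norm_le qPsi (is_primitiveZ M AP) x0t.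
  move=> /(_ _)/le_trans; apply.
    move=> s; rewrite in_itv/= => /andP[x0s st].
    rewrite normrM mulrC ler_wpM2r// ger0_norm//; apply: cmax.
    by rewrite in_itv/= x0s (le_trans st).
  rewrite -mulrBr -[M / 2]/(M * 2^-1) ler_wpM2l// -[2^-1]mul1r.
  by rewrite (le_trans _ Ad)// lerB// Amono.
have PM : M <= M / 2.
  have := MVT_segment x0c (fun t _ => dPsi t) (continuous_subspaceT cPsi).
  move=> [t]; rewrite in_itv/= => /andP[x0t tc]; rewrite Px0 subr0 -/M => ME.
  have := P'M t x0t (le_trans tc cd) => Pt.
  rewrite [leLHS]ME (le_trans (ler_norm _))// normrM -[leRHS]mulr1.
  have c1 : `|c - x0| <= 1 by rewrite ger0_norm ?subr_ge0//; lra.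
  exact: ler_pM.
have x0d' : x0 < x0 + d by rewrite ltrDl.
(* M <= M / 2 forces M <= 0, yet the segment contains a point where [Psi] equals psi > 0. *)
have [y /andP[x0y yd] psiy] := ae_witness x0d' psiPsi.
have yI : y \in `[x0, x0 + d] by rewrite in_itv/= (ltW x0y) (ltW yd).
have := cmax y yI; have := psi0 y; rewrite psiy; move: PM; lra.
Qed.

End ground_states.

(** * The ground state representation and slow cutoffs *)

Section criticality.
Set Implicit Arguments. Unset Strict Implicit.
Context {R : realType}.
Notation mu := (@lebesgue_measure R).
Implicit Types (f g w Q V U psi Psi : R -> R) (a b c x E : R).

Lemma L2loc_L1loc f : L2loc f -> L1loc f.
Proof.
move=> [mf If]; split=> // a b.
have Lf2 : L1loc (fun x => f x ^+ 2).
  by split=> //; exact: measurable_funX.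
have Lc : L1loc (cst 1 : R -> R) by apply: continuous_L1loc => x; exact: cvg_cst.
apply: le_integrable (L1loc_integrable a b (L1locD Lc Lf2)) => //.
  by apply/measurable_EFinP; exact: measurable_funTS.
move=> x _ /=; rewrite lee_fin [leRHS]ger0_norm ?addr_ge0 ?sqr_ge0//.
rewrite -(real_normK (num_real (f x))).
have := sqr_ge0 (`|f x| - 1); rewrite sqrrB1 => h.
have := normr_ge0 (f x); set t := `|f x| in h *; lra.
Qed.

(* With eta = Psi f and zeta = Psi f^2 one has
   eta'^2 + (Q - E) eta^2 = Psi^2 f'^2 + (Psi' zeta' + (Q - E) Psi zeta),
   and the last bracket integrates to 0 because Psi'' = (Q - E) Psi. *)
Lemma ground_state_representation Q V E Psi Psi' f f' : L1loc Q -> L1loc V ->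
  has_derivative Psi Psi' -> is_primitive (fun x => (Q x - E) * Psi x) Psi' ->
  has_derivative f f' -> continuous f' -> compact_support f ->
  form_bounded_below (fun x => Q x + V x) E ->
  0 <= \int[mu]_x (Psi x ^+ 2 * f' x ^+ 2 + V x * Psi x ^+ 2 * f x ^+ 2).
Proof.
move=> LQ LV dPsi PsiP df cf' f0 QVE.
have cPsi := has_derivative_continuous dPsi.
have cPsi' := is_primitive_continuous PsiP.
have cf := has_derivative_continuous df.
have f'0 : compact_support f'.
  by have [m hm] := f0; exists m; exact: derivative_support df hm.
pose eta x := Psi x * f x; pose eta' x := Psi x * f' x + f x * Psi' x.
have deta : has_derivative eta eta' by exact: has_derivativeM.
have cM (u v : R -> R) : continuous u -> continuous v -> continuous (fun x => u x * v x).
  by move=> cu cv x; apply: cvgM; [exact: cu|exact: cv].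
have cD (u v : R -> R) : continuous u -> continuous v -> continuous (fun x => u x + v x).
  by move=> cu cv x; apply: cvgD; [exact: cu|exact: cv].
have ceta : continuous eta by exact: cM.
have ceta' : continuous eta' by apply: cD; exact: cM.
have eta0 : compact_support eta by exact: compact_supportMr.
pose zeta x := eta x * f x; pose zeta' x := eta x * f' x + f x * eta' x.
have dzeta : has_derivative zeta zeta' by exact: has_derivativeM.
have czeta : continuous zeta by exact: cM.
have czeta' : continuous zeta' by apply: cD; exact: cM.
have zeta0 : compact_support zeta by exact: compact_supportMr.
have zeta'0 : compact_support zeta'.
  by have [m hm] := zeta0; exists m; exact: derivative_support dzeta hm.
have LQV := L1locD LQ LV.
have := form_lower_bound_C1 LQV QVE deta ceta' eta0.
set g := fun x => Psi x ^+ 2 * f' x ^+ 2 + V x * Psi x ^+ 2 * f x ^+ 2.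
pose h1 x := (Q x - E) * Psi x * zeta x; pose h2 x := Psi' x * zeta' x.
have -> : \int[mu]_x (eta' x ^+ 2 + (Q x + V x - E) * eta x ^+ 2) =
    \int[mu]_x (g x + (h1 x + h2 x)).
  by apply: eq_Rintegral => x _; rewrite /g /h1 /h2 /zeta' /zeta /eta' /eta; ring.
have LP2 : L1loc (fun x => V x * Psi x ^+ 2) by apply: L1locM => //; exact: continuousX.
have ig : mu.-integrable setT (EFin \o g).
  apply: compact_support_integrable.
    apply: L1locD.
      by apply: continuous_L1loc; apply: cM; exact: continuousX.
    by apply: L1locM => //; exact: continuousX.
  by apply: compact_supportD; apply: compact_supportMr; exact: compact_supportX.
have i1 : mu.-integrable setT (EFin \o h1) := L1loc_test_integrable PsiP.1 czeta zeta0.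
have i2 : mu.-integrable setT (EFin \o h2).
  exact: L1loc_test_integrable (continuous_L1loc cPsi') czeta' zeta'0.
have i12 : mu.-integrable setT (EFin \o (fun x => h1 x + h2 x)).
  by have := integrableD _ i1 i2; apply.
rewrite RintegralD// (RintegralD _ i1 i2)//.
have h12 : \int[mu]_x h1 x = - \int[mu]_x h2 x := Rintegral_parts_test PsiP dzeta czeta' zeta0.
by rewrite [X in _ + (X + _)]h12 addNr addr0.
Qed.

(** An upper bound c for [W] on the half-line would bound the integrals of [w] over all [0, n] by c
    - W 0, against monotone convergence. *)
Lemma primitive_unbounded w W : continuous w -> (forall x, 0 <= w x) ->
  is_primitive w W -> (\int[mu]_(x in `[0%R, +oo[) (w x)%:E = +oo)%E ->
  forall c, exists2 x, 0 <= x & c < W x.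
Proof.
move=> cw w0 wW woo c; apply: contrapT => nW.
have Wc x : 0 <= x -> W x <= c.
  by move=> x0; rewrite leNgt; apply/negP => cW; apply: nW; exists x.
have := @ge0_cvgn_integral R mu w w0 (continuous_measurable_fun cw).
rewrite woo => cvgoo; suff : (+oo <= (c - W 0)%:E)%E by rewrite leye_eq.
apply: cvge_le cvgoo; near=> n.
have n0 : 0 <= (n%:R : R) by [].
rewrite -[leLHS]fineK; last by apply: integrable_fin_num => //; exact: wW.1.2.
rewrite lee_fin -/(Rintegral _ _ _) wW.2//.
by rewrite lerB// Wc.
Unshelve. all: by end_near. Qed.

(** The factor [k] lets the energy be stated in [w] alone: when w = Psi^-2 and f' = k w, the density
    Psi^2 f'^2 is k^2 w. *)
Lemma slow_cutoff w W : continuous w -> (forall x, 0 <= w x) -> is_primitive w W ->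
  (forall c, exists2 x, 0 <= x & c < W x) ->
  (forall c, exists2 x, x <= 0 & W x < c) ->
  forall N e, 0 <= N -> 0 < e -> exists f f', [/\ has_derivative f f', continuous f',
    compact_support f, forall x, `|x| <= N -> f x = 1 &
    exists2 k : R -> R, (forall x, f' x = k x * w x) &
      \int[mu]_x (k x ^+ 2 * w x) <= e].
Proof.
move=> cw w0 wW Wpos Wneg N e N0 e0.
have Wmono a b : a <= b -> W a <= W b.
  by move=> ab; rewrite -subr_ge0 -(wW.2 _ _ ab); apply: Rintegral_ge0.
have dW : has_derivative W w by move=> x; apply: (is_primitive_derive wW); exact: cw.
have cW := has_derivative_continuous dW.
have [chi [schi chi1 chi0 chi01]] := @cutoff R 1.
have dchi := smooth_has_derivative schi; set chi' := chi^`()%classic in dchi.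
have cchi' : continuous chi' by apply: smooth_continuous; exact: smooth_derive.
have chi02 x : 2 < `|x| -> chi x = 0 by move=> x2; apply: chi0; lra.
have chi'02 := derivative_support dchi chi02.
have cchi'2 : continuous (fun x => chi' x ^+ 2) by exact: continuousX.
have SP := primitiveP (continuous_L1loc cchi'2); set S := primitive _ in SP.
have dS : has_derivative S (fun x => chi' x ^+ 2).
  by move=> x; apply: (is_primitive_derive SP); exact: cchi'2.
(* [chi'] vanishes beyond 2, so its squared primitive [S] is constant outside [-3, 3]; the radius 3
   keeps the inequality with 2 strict. *)
have Sle x : `|S x| <= S 3 - S (-3).
  have Smono a b : a <= b -> S a <= S b.
    by move=> ab; rewrite -subr_ge0 -(SP.2 _ _ ab); apply: Rintegral_ge0 => t _; exact: sqr_ge0.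
  have S0 : S 0 = 0 by exact: primitive0.
  have Sr y : 3 <= y -> S y = S 3.
    move=> y3; apply: (is_primitive_const SP y3) => t; rewrite in_itv/= => /andP[t3 _].
    by rewrite chi'02 ?expr0n// gtr0_norm; lra.
  have Sl y : y <= -3 -> S y = S (-3).
    move=> y3; apply/esym; apply: (is_primitive_const SP y3) => t.
    rewrite in_itv/= => /andP[_ t3].
    by rewrite chi'02 ?expr0n// ltr0_norm; lra.
  have s3 : 0 <= S 3 by rewrite -S0 Smono.
  have s3' : S (-3) <= 0 by rewrite -S0 Smono// oppr_le0.
  have Sle3 : S x <= S 3.
    by have [/Sr ->|/ltW/Smono] := leP 3 x.
  have Sge3 : S (-3) <= S x.
    by have [/Sl ->|/ltW/Smono] := leP x (-3).
  rewrite ler_norml; apply/andP; split.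
    by rewrite opprB (le_trans _ Sge3)// gerBl.
  by rewrite (le_trans Sle3)// lerBrDr gerDl.
pose B := S 3 - S (-3).
(* The 1 gives positivity, the next two terms give |W / T| <= 1 on [-N, N], where the cutoff must be
   1, and the last one gives 2 B / T <= e. *)
pose T := 1 + `|W N| + `|W (- N)| + 2 * B / e.
have B0 : 0 <= B by rewrite (le_trans _ (Sle 0)).
have T0 : 0 < T by rewrite /T -!addrA ltr_pwDl// !addr_ge0// divr_ge0 ?mulr_ge0// ltW.
have TN x : `|x| <= N -> `|W x| <= T.
  rewrite ler_norml => /andP[/Wmono Nx /Wmono xN].
  have := ler_norm (W N); have := ler_norm (- W (- N)); rewrite normrN => h1 h2.
  have h3 : 0 <= 2 * B / e by rewrite divr_ge0 ?mulr_ge0// ltW.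
  have := normr_ge0 (W N); have := normr_ge0 (W (- N)).
  by rewrite ler_norml /T; lra.
have [b b0 Wb] := Wpos (2 * T); have [a a0 Wa] := Wneg (- (2 * T)).
(* As a <= 0 <= b, any x with |x| > L lies to the right of [b] or to the left of [a]. *)
pose L := b - a.
have WL x : L < `|x| -> 2 * T < `|W x|.
  rewrite !lter_normr => /orP[xL|xL]; apply/orP.
    by left; apply: (lt_le_trans Wb); apply: Wmono; rewrite /L in xL; lra.
  right; rewrite ltrNr; apply: le_lt_trans Wa; apply: Wmono; rewrite /L in xL; lra.
pose u x := T^-1 * W x.
have du : has_derivative u (fun x => T^-1 * w x) by exact: has_derivativeZ.
have u2 x : 2 < `|u x| = (2 * T < `|W x|).
  by rewrite /u normrM gtr0_norm ?invr_gt0// mulrC ltr_pdivlMr.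
have df := has_derivative_comp dchi du.
pose k x := chi' (u x) * T^-1.
have cu := has_derivative_continuous du.
have ck : continuous k.
  move=> x; apply: cvgM; last exact: cvg_cst.
  by apply: (@continuous_comp _ _ _ u chi'); [exact: cu|exact: cchi'].
have k0 x : L < `|x| -> k x = 0.
  by move=> /WL Wx; rewrite /k chi'02 ?mul0r// u2.
exists (fun x => chi (u x)), (fun x => chi' (u x) * (T^-1 * w x)); split=> //.
- move=> x; rewrite (_ : (fun x => _) = (fun x => k x * w x)).
    by apply: cvgM; [exact: ck|exact: cw].
  by apply/funext => y; rewrite /k mulrA.
- by exists L => x /WL Wx; rewrite chi02// u2.
- move=> x /TN xN; apply: chi1.
  by rewrite /u normrM gtr0_norm ?invr_gt0// mulrC ler_pdivrMr// mul1r.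
exists k => [x|]; first by rewrite /k mulrA.
have L0 : 0 <= L by rewrite /L; lra.
rewrite (@Rintegral_compact_support _ _ L); last first.
  by move=> x /k0 ->; rewrite expr0n mul0r.
(* The chain rule exhibits T^-1 S(u) as an antiderivative of k^2 w, in place of a change of
   variables. *)
have dSu := has_derivativeZ T^-1 (has_derivative_comp dS du).
have ckw : continuous (fun x => k x ^+ 2 * w x).
  by move=> x; apply: cvgM; [exact: (continuousX ck)|exact: cw].
rewrite (_ : (fun x => T^-1 * (chi' (u x) ^+ 2 * (T^-1 * w x))) =
             (fun x => k x ^+ 2 * w x)) in dSu; last first.
  by apply/funext => x; rewrite /k; ring.
rewrite (has_derivative_primitive ckw dSu).2; last by lra.
rewrite -mulrBr mulrC ler_pdivrMr// (le_trans (ler_norm _))//.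
rewrite (le_trans (ler_normB _ _))// (le_trans (lerD (Sle _) (Sle _)))//.
have -> : e * T = e * (1 + `|W N| + `|W (- N)|) + 2 * B.
  by rewrite /T mulrDr [e * (2 * B / e)]mulrC divfK// gt_eqF.
have : 0 <= e * (1 + `|W N| + `|W (- N)|) by rewrite mulr_ge0 ?addr_ge0// ltW.
by rewrite -/B mulr2n mulrDl mul1r lerDr.
Qed.

End criticality.

(** * Perturbation of almost constant functions *)

Section rigidity.
Set Implicit Arguments. Unset Strict Implicit.
Context {R : realType}.
Notation mu := (@lebesgue_measure R).
Implicit Types (f g P U : R -> R) (c x : R).

(* Testing |int U f^2| <= int P f'^2 with f + t g, where f = 1 on the support of g
   and int P f'^2 is small, gives |2 t int U g| <= C t^2 for all t. *)
Lemma weight_orthogonal_to_tests P U g : continuous P -> (forall x, 0 <= P x) -> L1loc U ->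
  (forall f f', has_derivative f f' -> continuous f' -> compact_support f ->
    `|\int[mu]_x (U x * f x ^+ 2)| <= \int[mu]_x (P x * f' x ^+ 2)) ->
  (forall N e, 0 <= N -> 0 < e -> exists f f', [/\ has_derivative f f', continuous f',
    compact_support f, forall x, `|x| <= N -> f x = 1 &
    \int[mu]_x (P x * f' x ^+ 2) <= e]) ->
  smooth_compact g -> \int[mu]_x (U x * g x) = 0.
Proof.
move=> cP P0 LU UP cut [sg [m gm]].
pose M : R := `|m|; have M0 : 0 <= M by exact: normr_ge0.
have g0 : compact_support g by exists m.
have gM x : M < `|x| -> g x = 0.
  by move=> Mx; apply: gm; exact: le_lt_trans (ler_norm _) Mx.
have dg := smooth_has_derivative sg; set g' := g^`()%classic in dg.
have cg := smooth_continuous sg.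
have cg' : continuous g' by apply: smooth_continuous; exact: smooth_derive.
have g'M := derivative_support dg gM.
have g'0 : compact_support g' by exists M.
have LP := continuous_L1loc cP.
set B := Rintegral _ _ _.
pose a2 := \int[mu]_x (P x * g' x ^+ 2); pose v2 := \int[mu]_x (U x * g x ^+ 2).
have i2 h : L1loc h -> forall f, continuous f -> compact_support f ->
    mu.-integrable setT (EFin \o (fun x => h x * f x ^+ 2)).
  move=> Lh f cf f0; apply: (L1loc_test_integrable Lh); first exact: continuousX.
  exact: compact_supportX.
have iZ h c : mu.-integrable setT (EFin \o h) ->
    mu.-integrable setT (EFin \o (fun x => c * h x)).
  by move=> ih; have := integrableZl _ c ih; apply.
have iD h1 h2 : mu.-integrable setT (EFin \o h1) -> mu.-integrable setT (EFin \o h2) ->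
    mu.-integrable setT (EFin \o (fun x => h1 x + h2 x)).
  by move=> ih1 ih2; have := integrableD _ ih1 ih2; apply.
(* The cutoff equals 1 one unit beyond the support of [g], so it is locally constant there: f g = g
   and f' g' = 0 hold everywhere. The error e enters twice, as the energy of [f] and as the bound on
   int U f^2. *)
have key t e : 0 < e -> 2 * t * B <= 2 * e + t ^+ 2 * (a2 + `|v2|).
  move=> e0; have M1 : 0 <= M + 1 by lra.
  have [f [f' [df cf' f0 f1 fe]]] := cut (M + 1) e M1 e0.
  have cf := has_derivative_continuous df.
  have f'0 : compact_support f'.
    by have [n fn] := f0; exists n; exact: derivative_support df fn.
  have fg x : f x * g x = g x.
    have [xM|/gM ->] := leP `|x| M; last by rewrite mulr0.
    by rewrite f1 ?mul1r//; lra.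
  have f'g' x : f' x * g' x = 0.
    have [xM|/g'M ->] := leP `|x| M; last by rewrite mulr0.
    rewrite (derivative_locally_cst (c := 1) df) ?mul0r//.
    have xI : x \in `]- (M + 1), M + 1[.
      by rewrite in_itv/= -ltr_norml; lra.
    apply: filterS (near_in_itvoo xI) => y; rewrite in_itv/= -ltr_norml => yM.
    by apply: f1; exact: ltW.
  have dft := has_derivativeD df (has_derivativeZ t dg).
  have cft' : continuous (fun x => f' x + t * g' x).
    move=> x; apply: cvgD; first exact: cf'.
    by apply: cvgM; [exact: cvg_cst|exact: cg'].
  have ft0 : compact_support (fun x => f x + t * g x).
    exact: (compact_supportD f0 (compact_supportMr (fun=> t) g0)).
  have := UP _ _ dft cft' ft0; have := UP _ _ df cf' f0.
  have -> : \int[mu]_x (P x * (f' x + t * g' x) ^+ 2) =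
      \int[mu]_x (P x * f' x ^+ 2) + t ^+ 2 * a2.
    rewrite -RintegralZl//; last exact: i2.
    rewrite -RintegralD//; [|exact: i2|by apply: iZ; exact: i2].
    apply: eq_Rintegral => x _.
    rewrite sqrrD exprMn (mulrCA (f' x)) f'g' mulr0 mul0rn addr0; ring.
  have -> : \int[mu]_x (U x * (f x + t * g x) ^+ 2) =
      \int[mu]_x (U x * f x ^+ 2) + (2 * t * B + t ^+ 2 * v2).
    have iUg := L1loc_test_integrable LU cg g0.
    have iUg2 := i2 _ LU _ cg g0.
    rewrite -!RintegralZl//.
    rewrite -RintegralD//; [|exact: iZ..].
    rewrite -RintegralD//; [|exact: i2|by apply: iD; exact: iZ].
    apply: eq_Rintegral => x _.
    by rewrite sqrrD exprMn (mulrCA (f x)) fg; ring.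
  set A := \int[mu]_x (P x * f' x ^+ 2) in fe *.
  set v := \int[mu]_x (U x * f x ^+ 2).
  move=> h1 h2.
  have h3 := ler_norm (v + (2 * t * B + t ^+ 2 * v2)).
  have h4 := ler_norm (- v); rewrite normrN in h4.
  have h5 : - (t ^+ 2 * v2) <= t ^+ 2 * `|v2|.
    by rewrite -mulrN ler_wpM2l ?sqr_ge0// -normrN ler_norm.
  by rewrite mulrDr; lra.
pose C := a2 + `|v2|.
have C0 : 0 <= C.
  by rewrite addr_ge0//; apply: Rintegral_ge0 => x _; rewrite mulr_ge0 ?sqr_ge0.
have C1 : 0 < C + 1 by lra.
(* With t = s the bound becomes 2 s^2 (C + 1) <= s^2 C, hence s = 0; the added 1 covers C = 0. *)
pose s := B / (C + 1).
have BE : B = s * (C + 1) by rewrite /s divfK// gt_eqF.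
have : 2 * s * B <= s ^+ 2 * C.
  apply/ler_addgt0Pl => e e0; have := key s (e / 2) (divr_gt0 e0 (ltr0Sn _ 1)).
  by rewrite -/C; lra.
rewrite BE expr2 => h.
have s20 : s * s * (C + 2) <= 0 by lra.
have : s * s <= 0 by rewrite -(pmulr_lle0 _ (_ : 0 < C + 2)); lra.
rewrite -expr2 => s2; have : s ^+ 2 == 0 by rewrite eq_le s2 sqr_ge0.
by rewrite sqrf_eq0 => /eqP ->; rewrite mul0r.
Qed.

End rigidity.

(** * Conclusion: vanishing of V almost everywhere *)

Theorem theorem4p3 (R : realType) (Q V psi : R -> R) (E0 : R) :
  L2loc Q ->
  bottom_of_spectrum Q E0 ->
  positive_ground_state Q E0 psi ->
  (\int[@lebesgue_measure R]_(t in `[0%R, +oo[) ((psi t) ^- 2)%:E = +oo)%E ->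
  (\int[@lebesgue_measure R]_(t in `]-oo, 0%R]) ((psi t) ^- 2)%:E = +oo)%E ->
  L2loc V ->
  form_bounded_below (fun x => Q x + V x) E0 ->
  form_bounded_below (fun x => Q x - V x) E0 ->
  {ae @lebesgue_measure R, forall x, V x = 0}.
Proof.
move=> /L2loc_L1loc LQ _ [weak psi0] psi_pos psi_neg /L2loc_L1loc LV QV QNV.
have [Psi [Psi' [psiPsi dPsi PsiP]]] := weak_solution_regularity LQ weak.
have cPsi := has_derivative_continuous dPsi.
have LQE : L1loc (fun x => Q x - E0).
  by apply: L1locB => //; apply: continuous_L1loc => x; exact: cvg_cst.
have Psi0 := solution_gt0 LQE psi0 psiPsi dPsi PsiP.
pose w x := (Psi x) ^- 2.
have w0 x : 0 <= w x by rewrite /w invr_ge0 sqr_ge0.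
have cw : continuous w.
  move=> x; apply: cvgV; first by rewrite expf_neq0// gt_eqF.
  exact: continuousX.
(* psi is only measurable, so its inverse square is written as exp(- 2 ln psi). *)
have mpsi : measurable_fun setT (fun x => (psi x) ^- 2).
  rewrite (_ : (fun x => _) = (fun x => expR (- (ln (psi x) + ln (psi x))))).
    have mln : measurable_fun setT (fun x => ln (psi x)).
      by apply: measurableT_comp; [exact: measurable_ln|exact: weak.1.1].
    apply: measurableT_comp; first exact: measurable_expR.
    by apply: measurableT_comp => //; exact: measurable_funD.
  by apply/funext => x; rewrite expRN expRD lnK// posrE.
(* The divergence hypotheses concern psi, while [W] is built from the continuous representative
   [Psi]. *)
have psiw D : measurable D ->
    (\int[lebesgue_measure]_(t in D) ((psi t) ^- 2)%:E =
     \int[lebesgue_measure]_(t in D) (w t)%:E)%E.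
  move=> mD; apply: ge0_ae_eq_integral => //.
  - by apply/measurable_EFinP; exact: measurable_funTS.
  - by apply/measurable_EFinP; apply: measurable_funTS; exact: continuous_measurable_fun.
  - by move=> x _; rewrite lee_fin invr_ge0 sqr_ge0.
  - by move=> x _; rewrite lee_fin.
  - by apply: (@filterS _ _ (ae_filter_ringOfSetsType _)) psiPsi => x; rewrite /w => ->.
have wP := primitiveP (continuous_L1loc cw); set W := primitive w in wP.
have Wpos : forall c, exists2 x, 0 <= x & c < W x.
  by apply: (primitive_unbounded cw w0 wP); rewrite -psiw.
(* Reflection x -> - x reduces the left end to the right one: -W(-x) is a primitive of w(-x). *)
have Wneg : forall c, exists2 x, x <= 0 & W x < c.
  pose wN x := w (- x); pose WN x := -1 * W (- x).
  have cwN : continuous wN.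
    by move=> x; apply: (@continuous_comp _ _ _ -%R w); [exact: opp_continuous|exact: cw].
  have dW : has_derivative W w by move=> x; apply: (is_primitive_derive wP); exact: cw.
  have dN : has_derivative (-%R : R -> R) (cst (-1)).
    by move=> x; exact: is_deriveNid.
  have wNP : is_primitive wN WN.
    apply: has_derivative_primitive; first exact: cwN.
    have := has_derivativeZ (-1) (has_derivative_comp dW dN).
    by under [X in has_derivative _ X]eq_fun do rewrite /= mulrN1 mulN1r opprK.
  have := primitive_unbounded cwN (fun x => w0 (- x)) wNP.
  rewrite -(@ge0_integration_by_substitutionNy _ w 0); last 2 first.
  - exact: continuous_subspaceT.
  - by move=> x _; exact: w0.
  rewrite oppr0 -psiw// => /(_ psi_neg) WNu c.
  have [x x0 cx] := WNu (- c); exists (- x); first by rewrite oppr_le0.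
  by rewrite /WN mulN1r ltrN2 in cx.
pose U x := V x * Psi x ^+ 2.
have LU : L1loc U by apply: L1locM => //; exact: continuousX.
have Psi2 x : Psi x ^+ 2 != 0 by rewrite expf_neq0// gt_eqF.
have U0 : {ae lebesgue_measure, forall x, U x = 0}.
  apply: fundamental_lemma_variations => // g.
  apply: (@weight_orthogonal_to_tests _ (fun x => Psi x ^+ 2)) => //.
  - exact: continuousX.
  - by move=> x; exact: sqr_ge0.
  - move=> f f' df cf' f0.
    have cf := has_derivative_continuous df.
    have f'0 : compact_support f'.
      by have [n fn] := f0; exists n; exact: derivative_support df fn.
    have LNV := L1locN LV.
    have h1 := ground_state_representation LQ LV dPsi PsiP df cf' f0 QV.
    have h2 := ground_state_representation LQ LNV dPsi PsiP df cf' f0 QNV.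
    have iP : lebesgue_measure.-integrable setT (EFin \o (fun x => Psi x ^+ 2 * f' x ^+ 2)).
      apply: (L1loc_test_integrable (continuous_L1loc (continuousX (n := 2) cPsi))).
        exact: continuousX.
      exact: compact_supportX.
    have iU : lebesgue_measure.-integrable setT (EFin \o (fun x => U x * f x ^+ 2)).
      by apply: (L1loc_test_integrable LU); [exact: continuousX|exact: compact_supportX].
    rewrite RintegralD// in h1.
    rewrite (_ : Rintegral _ _ _ = Rintegral lebesgue_measure setT
      (fun x => Psi x ^+ 2 * f' x ^+ 2 - U x * f x ^+ 2)) in h2; last first.
      by apply: eq_Rintegral => x _; rewrite /U; ring.
    rewrite RintegralB// in h2.
    (* The bound for Q + V gives the lower estimate, the bound for Q - V the upper one. *)
    rewrite ler_norml; apply/andP; split.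
      by rewrite -subr_ge0 opprK addrC; exact: h1.
    by rewrite -subr_ge0; exact: h2.
  - move=> N e N0 e0.
    have [f [f' [df cf' f0 f1 [k fk ke]]]] := slow_cutoff cw w0 wP Wpos Wneg N0 e0.
    exists f, f'; split=> //; rewrite (le_trans _ ke)// le_eqVlt; apply/orP; left; apply/eqP.
    by apply: eq_Rintegral => x _; rewrite fk /w; field; rewrite gt_eqF.
apply: (@filterS _ _ (ae_filter_ringOfSetsType _)) U0 => x /eqP.
by rewrite /U mulf_eq0 (negPf (Psi2 x)) orbF => /eqP.
Qed.
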